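(* Both $2$-functors $?/G\colon G\text{-}\mathbf{Cat}\to G\text{-}\mathbf{GrCat}$ and $?\#G\colon G\text{-}\mathbf{GrCat}\to G\text{-}\mathbf{Cat}$ are $2$-equivalences. They are mutual $2$-quasi-inverses. Hence the $2$-categories $G\text{-}\mathbf{Cat}$ and $G\text{-}\mathbf{GrCat}$ are $2$-equivalent. More precisely, there are four $2$-natural isomorphisms $$\varepsilon\colon\mathrm{id}_{G\text{-}\mathbf{Cat}}\Rightarrow(?\#G)(?/G),\qquad \varepsilon'\colon(?\#G)(?/G)\Rightarrow\mathrm{id}_{G\text{-}\mathbf{Cat}},$$ $$\omega\colon\mathrm{id}_{G\text{-}\mathbf{GrCat}}\Rightarrow(?/G)(?\#G),\qquad \omega'\colon(?/G)(?\#G)\Rightarrow\mathrm{id}_{G\text{-}\mathbf{GrCat}}$$ such that for all $\mathcal{C}\in G\text{-}\mathbf{Cat}$ and $\mathcal{B}\in G\text{-}\mathbf{GrCat}$ $$\varepsilon'_{\mathcal{C}}\varepsilon_{\mathcal{C}}=\mathrm{id}_{\mathcal{C}},\quad \varepsilon_{\mathcal{C}}\varepsilon'_{\mathcal{C}}\cong\mathrm{id}_{(\mathcal{C}/G)\#G},\quad \omega'_{\mathcal{B}}\omega_{\mathcal{B}}=\mathrm{id}_{\mathcal{B}},\quad \omega_{\mathcal{B}}\omega'_{\mathcal{B}}\cong\mathrm{id}_{(\mathcal{B}\#G)/G},$$ and such that $\varepsilon'_{\mathcal{C}}$ is a strictly $G$-equivariant functor and $\omega_{\mathcal{B}}$ is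 a strictly degree-preserving functor for all $\mathcal{C}\in G\text{-}\mathbf{Cat}$ and $\mathcal{B}\in G\text{-}\mathbf{GrCat}$. Furthermore, $\varepsilon$ and $\omega'$ are strictly $2$-natural transformations, and in particular $?/G$ is strictly left $2$-adjoint to $?\#G$ (with unit $\varepsilon$ and counit $\omega'$); namely, the pasting of $\varepsilon$ and $\omega'$ along $?\#G$ is the identity $\mathrm{id}_{?\#G}$, i.e. $(\omega'_{\mathcal{B}}\#G)\circ\varepsilon_{\mathcal{B}\#G}=\mathrm{id}_{\mathcal{B}\#G}$ for all $\mathcal{B}$, and the pasting of $\varepsilon$ and $\omega'$ along $?/G$ is the identity $\mathrm{id}_{?/G}$, i.e. $\omega'_{\mathcal{C}/G}\circ(\varepsilon_{\mathcal{C}}/G)=\mathrm{id}_{\mathcal{C}/G}$ for all $\mathcal{C}$.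
   Context: Throughout, $G$ is a group, $\Bbbk$ is a commutative ring, and all categories and functors are $\Bbbk$-linear. $\mathcal{C}_0$ is the class of objects of $\mathcal{C}$. 2-categories are strict 2-categories. **The 2-category $G\text{-}\mathbf{Cat}$.** A $G$-category is a $\Bbbk$-category $\mathcal{C}$ with a group homomorphism $A\colon G\to\operatorname{Aut}(\mathcal{C})$, $a\mapsto A_a$ (all actions are denoted by $A$). A $G$-equivariant functor $\mathcal{C}\to\mathcal{C}'$ is a pair $(E,\rho)$ of a $\Bbbk$-functor $E\colon\mathcal{C}\to\mathcal{C}'$ and a family $\rho=(\rho_a)_{a\in G}$ of natural isomorphisms $\rho_a\colon A_aE\Rightarrow EA_a$ with $\rho_{ba}=(\rho_bA_a)\circ(A_b\rho_a)$ for all $a,b\in G$. It is strictly $G$-equivariant if $A_aE=EA_a$ and $\rho_a=\mathrm{id}_{EA_a}$ for all $a$. A morphism $(E,\rho)\to(E',\rho')$ is a natural transformation $\eta\colon E\Rightarrow E'$ with $(\eta A_a)\circ\rho_a=\rho'_a\circ(A_a\eta)$ for all $a\in G$. The composite is $(E',\rho')(E,\rho)=(E'E,((E'\rho_a)(\rho'_aE))_{a\in G})$. $G\text{-}\mathbf{Cat}$ has small $G$-categories as objects, $G$-equivariant functors as 1-morphisms, and morphisms of $G$-equivariant functors as 2-morphisms, with identities $(\mathrm{id},(\mathrm{id})_a)$ and the usual compositions of natural transformations. **The 2-category $G\text{-}\mathbf{GrCat}$.** A $G$-graded category is a $\Bbbk$-category $\mathcal{B}$ with decompositions $\mathcal{B}(x,y)=\bigoplus_{a\in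 G}\mathcal{B}^a(x,y)$ of $\Bbbk$-modules such that $\mathcal{B}^b(y,z)\cdot\mathcal{B}^a(x,y)\subseteq\mathcal{B}^{ba}(x,z)$. A degree-preserving functor $\mathcal{B}\to\mathcal{A}$ is a pair $(H,r)$ of a $\Bbbk$-functor $H$ and a map $r\colon\mathcal{B}_0\to G$ (the degree adjuster) with $H(\mathcal{B}^a(x,y))\subseteq\mathcal{A}^{r_y^{-1}ar_x}(Hx,Hy)$ for all $x,y\in\mathcal{B}_0$, $a\in G$; it is strictly degree-preserving if $r$ is constantly $1$. A morphism $(H,r)\to(I,s)$ is a natural transformation $\theta\colon H\Rightarrow I$ with $\theta x\in\mathcal{A}^{s_x^{-1}r_x}(Hx,Ix)$ for all $x$. The composite is $(H',r')(H,r)=(H'H,(r_xr'_{Hx})_x)$. $G\text{-}\mathbf{GrCat}$ has small $G$-graded categories as objects, these as 1- and 2-morphisms, identities $(\mathrm{id},1)$, and the usual compositions of natural transformations. **Orbit 2-functor $?/G$.** For a $G$-category $\mathcal{C}$, $\mathcal{C}/G$ has objects $\mathcal{C}_0$; $(\mathcal{C}/G)(x,y)$ is the set of all $f=(f_{b,a})\in\prod_{(a,b)\in G\times G}\mathcal{C}(A_ax,A_by)$ that are row finite and column finite and satisfy $f_{cb,ca}=A_cf_{b,a}$ for all $c\in G$; composition is $gf=(\sum_{c}g_{b,c}f_{c,a})_{(a,b)}$. The canonical functor $(P,\psi)\colon\mathcal{C}\to\mathcal{C}/G$ is $P(x)=x$, $P(f)=(\delta_{a,b}A_af)_{(a,b)}$,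 with natural isomorphisms $\psi_c\colon P\Rightarrow PA_c$, $\psi_cx=(\delta_{a,bc}\mathrm{id}_{A_ax})_{(a,b)}$. The map $P^{(1)}_{x,y}\colon\bigoplus_{a\in G}\mathcal{C}(A_ax,y)\to(\mathcal{C}/G)(Px,Py)$, $(f_a)_a\mapsto\sum_aP(f_a)\psi_ax$, is an isomorphism, and $\mathcal{C}/G$ is $G$-graded by $(\mathcal{C}/G)^a(x,y)=P^{(1)}_{x,y}(\mathcal{C}(A_ax,y))$. $?/G$ sends $\mathcal{C}$ to $\mathcal{C}/G$; sends $(E,\rho)\colon\mathcal{C}\to\mathcal{C}'$ to $(H,1)$, where $H\colon\mathcal{C}/G\to\mathcal{C}'/G$ is the unique functor with $HP=P'E$ and $H\psi_a=(P'\rho_a)(\psi'_aE)$ for all $a$ ($(P',\psi')$ being the canonical functor of $\mathcal{C}'$); and sends $\eta$ to $\eta/G$ with $(\eta/G)(Px)=P'(\eta x)$. **Smash 2-functor $?\#G$.** For a $G$-graded category $\mathcal{B}$, $\mathcal{B}\#G$ has objects $x^{(a)}:=(x,a)\in\mathcal{B}_0\times G$, morphisms $(\mathcal{B}\#G)(x^{(a)},y^{(b)})=\mathcal{B}^{b^{-1}a}(x,y)$, composition that of $\mathcal{B}$, and $G$-action $A_cx^{(a)}=x^{(ca)}$, $A_cf=f$. $?\#G$ sends $\mathcal{B}$ to $\mathcal{B}\#G$; sends $(H,r)$ to the strictly $G$-equivariant functor $x^{(a)}\mapsto(Hx)^{(ar_x)}$, $f\mapsto H(f)$; and sends $\theta$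 to $\theta\#G$ with $(\theta\#G)x^{(a)}=\theta x$. **Strict/weak terminology.** ''Strictly 2-natural transformation'' means a 2-natural transformation in the usual strict sense. ''2-natural transformation'' is used in a weak sense: the equalities defining a strict one are required only up to natural isomorphisms, i.e. the naturality square of each 1-morphism commutes up to a chosen 2-isomorphism, compatibly with 2-morphisms. A ''2-natural isomorphism'' is such a transformation whose components are equivalences in the target 2-category. Accordingly ''2-quasi-inverse'' and ''2-equivalence'' are in this weak sense: two 2-functors in opposite directions are mutual 2-quasi-inverses if both composites are 2-naturally isomorphic, in this sense, to the identities. The symbol $\cong$ between 1-morphisms means existence of an invertible 2-morphism. *)

(* Defs.v *)
From HB Require Import structures.
From mathcomp Require Import all_boot ssralg.
From mathcomp Require Import boolp classical_sets functions cardinality fsbigop.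

Set Implicit Arguments.
Unset Strict Implicit.
Unset Printing Implicit Defensive.

Import GRing.Theory.
Local Open Scope classical_set_scope.
Local Open Scope ring_scope.
#[local] Obligation Tactic := idtac.

Record kcat (k : comPzRingType) := KCat {
  ob :> Type;
  hom : ob -> ob -> lmodType k;
  idm : forall x, hom x x;
  cmp : forall x y z, hom y z -> hom x y -> hom x z;
  cmp_linl : forall x y z (f : hom x y), linear (fun g : hom y z => cmp g f);
  cmp_linr : forall x y z (g : hom y z), linear (fun f : hom x y => cmp g f);
  cmp1m : forall x y (f : hom x y), cmp (idm y) f = f;
  cmpm1 : forall x y (f : hom x y), cmp f (idm x) = f;
  cmpA : forall x y z t (h : hom z t) (g : hom y z) (f : hom x y),
    cmp h (cmp g f) = cmp (cmp h g) f }.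

Arguments hom {k} C x y : rename.
Arguments idm {k C} x : rename.
Arguments cmp {k C x y z} g f : rename.
Notation "g \c f" := (cmp g f) (at level 40, left associativity).

(* Equality of morphisms whose sources and targets are equal, but possibly not
   convertible (objects such as A_(b a) x and A_b (A_a x)). *)
Inductive hom_eq (k : comPzRingType) (C : kcat k) (x y : C) (f : hom C x y) :
    forall x' y' : C, hom C x' y' -> Prop :=
  hom_eq_refl : hom_eq f f.
Notation "f === g" := (hom_eq f g) (at level 70, no associativity).

Definition idto (k : comPzRingType) (C : kcat k) (x y : C) (e : x = y) :
    hom C x y :=
  match e in _ = z return hom C x z with erefl => idm x end.

Definition inverses (k : comPzRingType) (C : kcat k) (x y : C)
    (f : hom C x y) (g : hom C y x) : Prop :=
  g \c f = idm x /\ f \c g = idm y.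

Definition is_iso (k : comPzRingType) (C : kcat k) (x y : C)
    (f : hom C x y) : Prop := exists g, inverses f g.

Definition invm (k : comPzRingType) (C : kcat k) (x y : C) (f : hom C x y)
    (i : is_iso f) : hom C y x := projT1 (cid i).

Record kfun (k : comPzRingType) (C D : kcat k) := KFun {
  fob :> C -> D;
  fmor : forall x y, hom C x y -> hom D (fob x) (fob y);
  fmor_lin : forall x y, linear (@fmor x y);
  fmor1 : forall x, fmor (idm x) = idm (fob x);
  fmorM : forall x y z (g : hom C y z) (f : hom C x y),
    fmor (g \c f) = fmor g \c fmor f }.

Arguments fmor {k C D} F {x y} f : rename.

Record knat (k : comPzRingType) (C D : kcat k) (F F' : kfun C D) := KNat {
  napp :> forall x, hom D (F x) (F' x);
  nnat : forall x y (f : hom C x y), napp y \c fmor F f = fmor F' f \c napp x }.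

Section HomEq.
Context (k : comPzRingType) (C : kcat k).
Implicit Types x y z : C.

Lemma heq_inv x y x' y' (f : hom C x y) (f' : hom C x' y') : f === f' ->
  exists (p : x = x') (q : y = y'),
    f' = match p in _ = u, q in _ = v return hom C u v with
         | erefl, erefl => f end.
Proof. by case; exists erefl, erefl. Qed.

Lemma heq_eq x y (f g : hom C x y) : f === g -> f = g.
Proof.
case/heq_inv => p [q ->].
by rewrite (Prop_irrelevance p erefl) (Prop_irrelevance q erefl).
Qed.

Lemma eq_heq x y (f g : hom C x y) : f = g -> f === g.
Proof. by move->; exact: hom_eq_refl. Qed.

Lemma heq_sym x y x' y' (f : hom C x y) (g : hom C x' y') : f === g -> g === f.
Proof. by case; exact: hom_eq_refl. Qed.

Lemma heq_trans x y x' y' x2 y2 (f : hom C x y) (g : hom C x' y')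
  (h : hom C x2 y2) : f === g -> g === h -> f === h.
Proof. by move=> e; case; exact: e. Qed.

Lemma heq_cmp x y z x' y' z' (g : hom C y z) (f : hom C x y)
    (g' : hom C y' z') (f' : hom C x' y') :
  g === g' -> f === f' -> g \c f === g' \c f'.
Proof.
case/heq_inv => p [q ->] /heq_inv [r [s ->]].
case: _ / s p => p; rewrite (Prop_irrelevance p erefl).
by case: _ / q; case: _ / r; exact: hom_eq_refl.
Qed.

Lemma heq_idm x x' : x = x' -> idm x === idm x'.
Proof. by move->; exact: hom_eq_refl. Qed.

Lemma heq_idto x y (e : x = y) : idto e === idm x.
Proof. by case: _ / e; exact: hom_eq_refl. Qed.

Lemma heq_idto' x y (e : x = y) : idto e === idm y.
Proof. by case: _ / e; exact: hom_eq_refl. Qed.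

Lemma heq_idtol x y z (e : y = z) (f : hom C x y) : idto e \c f === f.
Proof. by case: _ / e; rewrite /= cmp1m; exact: hom_eq_refl. Qed.

Lemma heq_idtor x y z (e : x = y) (f : hom C y z) : f \c idto e === f.
Proof. by case: _ / e f => f; rewrite /= cmpm1; exact: hom_eq_refl. Qed.

Lemma heq0 x y x' y' : x = x' -> y = y' ->
  (0 : hom C x y) === (0 : hom C x' y').
Proof. by move=> -> ->; exact: hom_eq_refl. Qed.

Lemma heq_eq0 x y x' y' (f : hom C x y) (f' : hom C x' y') :
  f === f' -> f = 0 -> f' = 0.
Proof. by case. Qed.

Lemma heqZD (t : k) x y x' y' (f g : hom C x y) (f' g' : hom C x' y') :
  f === f' -> g === g' -> t *: f + g === t *: f' + g'.
Proof.
move=> e e'; destruct e.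
by rewrite (heq_eq e'); exact: hom_eq_refl.
Qed.

Lemma heq_fsum (I : choiceType) x y x' y' (F : I -> hom C x y)
    (F' : I -> hom C x' y') : x = x' -> y = y' -> (forall i, F i === F' i) ->
  \sum_(i \in [set: I]) F i === \sum_(i \in [set: I]) F' i.
Proof.
move=> ex ey; case: _ / ex F'; case: _ / ey => F' FF'.
suff -> : F = F' by exact: hom_eq_refl.
by apply/funext => i; exact/heq_eq.
Qed.

Lemma heq_inverses x y x' y' (f : hom C x y) (g : hom C y x)
    (f' : hom C x' y') (g' : hom C y' x') :
  inverses f g -> inverses f' g' -> f === f' -> g === g'.
Proof.
move=> [gf fg] [gf' fg'] e; destruct e.
by apply: eq_heq; rewrite -[g]cmpm1 -fg' cmpA gf cmp1m.
Qed.

Lemma invmP x y (f : hom C x y) (i : is_iso f) : inverses f (invm i).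
Proof. by rewrite /invm; case: cid. Qed.

Lemma inverses_cmp x y z (f : hom C x y) f' (g : hom C y z) g' :
  inverses f f' -> inverses g g' -> inverses (g \c f) (f' \c g').
Proof.
move=> [f'f ff'] [g'g gg']; split.
  by rewrite cmpA -(cmpA f') g'g cmpm1.
by rewrite cmpA -(cmpA g) ff' cmpm1.
Qed.

Lemma inverses_id x : inverses (idm x) (idm x).
Proof. by split; rewrite cmp1m. Qed.

Lemma cmpDm x y z (g g' : hom C y z) (f : hom C x y) :
  (g + g') \c f = g \c f + g' \c f.
Proof. by have := cmp_linl f 1 g g'; rewrite !scale1r. Qed.

Lemma cmpmD x y z (g : hom C y z) (f f' : hom C x y) :
  g \c (f + f') = g \c f + g \c f'.
Proof. by have := cmp_linr g 1 f f'; rewrite !scale1r. Qed.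

Lemma cmp0m x y z (f : hom C x y) : (0 : hom C y z) \c f = 0.
Proof. by apply: (addrI ((0 : hom C y z) \c f)); rewrite -cmpDm !addr0. Qed.

Lemma cmpm0 x y z (g : hom C y z) : g \c (0 : hom C x y) = 0.
Proof. by apply: (addrI (g \c (0 : hom C x y))); rewrite -cmpmD !addr0. Qed.

End HomEq.

Section Functors.
Context (k : comPzRingType).
Implicit Types C D : kcat k.

Lemma kfun_ext C D (F F' : kfun C D) : (forall x, F x = F' x) ->
  (forall x y (f : hom C x y), fmor F f === fmor F' f) -> F = F'.
Proof.
case: F F' => [o m l i c] [o' m' l' i' c'] /= oo' mm'.
have e : o = o' by exact/funext.
subst o'.
have e : m = m'.
  do 2 (apply: functional_extensionality_dep => ?).
  by apply/funext => f; exact/heq_eq/mm'.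
subst m'.
by f_equal; exact: Prop_irrelevance.
Qed.

Lemma knat_ext C D (F F' : kfun C D) (s t : knat F F') :
  (forall x, s x = t x) -> s = t.
Proof.
case: s t => [s ns] [t nt] /= st.
have e : s = t by exact: functional_extensionality_dep.
by subst t; f_equal; exact: Prop_irrelevance.
Qed.

Lemma heq_fmor C D (F : kfun C D) x y x' y' (f : hom C x y) (f' : hom C x' y') :
  f === f' -> fmor F f === fmor F f'.
Proof. by case; exact: hom_eq_refl. Qed.

Lemma heq_fun C D (F F' : kfun C D) x y (f : hom C x y) :
  F = F' -> fmor F f === fmor F' f.
Proof. by move->; exact: hom_eq_refl. Qed.

Lemma heq_napp C D (F F' : kfun C D) (s : knat F F') x x' :
  x = x' -> s x === s x'.
Proof. by move->; exact: hom_eq_refl. Qed.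

Lemma fmor0 C D (F : kfun C D) x y : fmor F (0 : hom C x y) = 0.
Proof.
apply: (addrI (fmor F (0 : hom C x y))).
by have := @fmor_lin _ _ _ F x y 1 0 0; rewrite !scale1r !addr0.
Qed.

Lemma fmorD C D (F : kfun C D) x y (f g : hom C x y) :
  fmor F (f + g) = fmor F f + fmor F g.
Proof. by have := @fmor_lin _ _ _ F x y 1 f g; rewrite !scale1r. Qed.

Lemma fmor_inverses C D (F : kfun C D) x y (f : hom C x y) g :
  inverses f g -> inverses (fmor F f) (fmor F g).
Proof. by move=> [e e']; split; rewrite -fmorM ?e ?e' fmor1. Qed.

Program Definition kid C : kfun C C :=
  @KFun _ _ _ (fun x => x) (fun _ _ f => f) _ _ _.
Next Obligation. by []. Qed.
Next Obligation. by []. Qed.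
Next Obligation. by []. Qed.

Program Definition kcomp C D D' (F' : kfun D D') (F : kfun C D) : kfun C D' :=
  @KFun _ _ _ (fun x => F' (F x)) (fun _ _ f => fmor F' (fmor F f)) _ _ _.
Next Obligation. by move=> C D D' F' F x y t f g /=; rewrite !fmor_lin. Qed.
Next Obligation. by move=> C D D' F' F x /=; rewrite !fmor1. Qed.
Next Obligation. by move=> C D D' F' F x y z g f /=; rewrite !fmorM. Qed.

Program Definition knat_id C D (F : kfun C D) : knat F F :=
  @KNat _ _ _ _ _ (fun x => idm (F x)) _.
Next Obligation. by move=> C D F x y f /=; rewrite cmp1m cmpm1. Qed.

Program Definition knat_vcomp C D (F F' F2 : kfun C D) (t : knat F' F2)
    (s : knat F F') : knat F F2 :=
  @KNat _ _ _ _ _ (fun x => t x \c s x) _.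
Next Obligation.
by move=> C D F F' F2 t s x y f /=; rewrite -cmpA nnat cmpA nnat -cmpA.
Qed.

Program Definition knat_hcomp C D D' (F F' : kfun C D) (H H' : kfun D D')
    (t : knat H H') (s : knat F F') : knat (kcomp H F) (kcomp H' F') :=
  @KNat _ _ _ _ _ (fun x => t (F' x) \c fmor H (s x)) _.
Next Obligation.
move=> C D D' F F' H H' t s x y f /=.
by rewrite -cmpA -fmorM (nnat s) fmorM cmpA (nnat t) -cmpA.
Qed.

End Functors.

(* The analogue of [hom_eq] for 2-cells: the 1-cells at both ends are equal. *)
Inductive cell_eq (H : Type) (K : H -> H -> Type) (f g : H) (s : K f g) :
    forall f' g' : H, K f' g' -> Prop :=
  cell_eq_refl : cell_eq s s.

Record twocat := TwoCat {
  ob2 :> Type;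
  hom1 : ob2 -> ob2 -> Type;
  hom2 : forall x y, hom1 x y -> hom1 x y -> Type;
  id1 : forall x, hom1 x x;
  comp1 : forall x y z, hom1 y z -> hom1 x y -> hom1 x z;
  id2 : forall x y (f : hom1 x y), hom2 f f;
  vcomp : forall x y (f g h : hom1 x y), hom2 g h -> hom2 f g -> hom2 f h;
  hcomp : forall x y z (g g' : hom1 y z) (f f' : hom1 x y),
    hom2 g g' -> hom2 f f' -> hom2 (comp1 g f) (comp1 g' f');
  comp1_idl : forall x y (f : hom1 x y), comp1 (id1 y) f = f;
  comp1_idr : forall x y (f : hom1 x y), comp1 f (id1 x) = f;
  comp1A : forall x y z t (h : hom1 z t) (g : hom1 y z) (f : hom1 x y),
    comp1 h (comp1 g f) = comp1 (comp1 h g) f;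
  vcomp_idl : forall x y (f g : hom1 x y) (s : hom2 f g), vcomp (id2 g) s = s;
  vcomp_idr : forall x y (f g : hom1 x y) (s : hom2 f g), vcomp s (id2 f) = s;
  vcompA : forall x y (f g h i : hom1 x y)
      (u : hom2 h i) (t : hom2 g h) (s : hom2 f g),
    vcomp u (vcomp t s) = vcomp (vcomp u t) s;
  hcomp_id2 : forall x y z (g : hom1 y z) (f : hom1 x y),
    hcomp (id2 g) (id2 f) = id2 (comp1 g f);
  hcomp_vcomp : forall x y z (g g' g2 : hom1 y z) (f f' f2 : hom1 x y)
      (t' : hom2 g' g2) (t : hom2 g g') (s' : hom2 f' f2) (s : hom2 f f'),
    hcomp (vcomp t' t) (vcomp s' s) = vcomp (hcomp t' s') (hcomp t s);
  hcomp_idl : forall x y (f f' : hom1 x y) (s : hom2 f f'),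
    cell_eq (K := @hom2 x y) (hcomp (id2 (id1 y)) s) s;
  hcomp_idr : forall x y (f f' : hom1 x y) (s : hom2 f f'),
    cell_eq (K := @hom2 x y) (hcomp s (id2 (id1 x))) s;
  hcompA : forall x y z t (h h' : hom1 z t) (g g' : hom1 y z) (f f' : hom1 x y)
      (v : hom2 h h') (u : hom2 g g') (s : hom2 f f'),
    cell_eq (K := @hom2 x t) (hcomp v (hcomp u s)) (hcomp (hcomp v u) s) }.

Arguments hom1 {t} x y : rename.
Arguments hom2 {t x y} f g : rename.
Arguments id1 {t} x : rename.
Arguments comp1 {t x y z} g f : rename.
Arguments id2 {t x y} f : rename.
Arguments vcomp {t x y f g h} _ _ : rename.
Arguments hcomp {t x y z g g' f f'} _ _ : rename.

Notation "s ==2 t" := (cell_eq (K := hom2) s t) (at level 70, no associativity).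

Section CellEq.
Context (T : twocat).

Lemma cell_eq_inv (x y : T) (f g f' g' : hom1 x y) (s : hom2 f g)
    (t : hom2 f' g') : s ==2 t -> exists (p : f = f') (q : g = g'),
  t = match p in _ = u, q in _ = v return hom2 u v with erefl, erefl => s end.
Proof. by case; exists erefl, erefl. Qed.

Lemma cell_eq_eq (x y : T) (f g : hom1 x y) (s t : hom2 f g) : s ==2 t -> s = t.
Proof.
case/cell_eq_inv => p [q ->].
by rewrite (Prop_irrelevance p erefl) (Prop_irrelevance q erefl).
Qed.

Lemma eq_cell_eq (x y : T) (f g : hom1 x y) (s t : hom2 f g) : s = t -> s ==2 t.
Proof. by move->; exact: cell_eq_refl. Qed.

Lemma cell_eq_sym (x y : T) (f g f' g' : hom1 x y)
  (s : hom2 f g) (t : hom2 f' g') : s ==2 t -> t ==2 s.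
Proof. by case; exact: cell_eq_refl. Qed.

Lemma cell_eq_trans (x y : T) (f g f' g' f2 g2 : hom1 x y)
    (s : hom2 f g) (t : hom2 f' g') (u : hom2 f2 g2) :
  s ==2 t -> t ==2 u -> s ==2 u.
Proof. by move=> e; case; exact: e. Qed.

End CellEq.

Record twofun (S T : twocat) := TwoFun {
  fun0 :> S -> T;
  fun1 : forall x y, hom1 x y -> hom1 (fun0 x) (fun0 y);
  fun2 : forall x y (f g : hom1 x y), hom2 f g -> hom2 (fun1 f) (fun1 g);
  fun1_id : forall x, fun1 (id1 x) = id1 (fun0 x);
  fun1_comp : forall x y z (g : hom1 y z) (f : hom1 x y),
    fun1 (comp1 g f) = comp1 (fun1 g) (fun1 f);
  fun2_id : forall x y (f : hom1 x y), fun2 (id2 f) = id2 (fun1 f);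
  fun2_vcomp : forall x y (f g h : hom1 x y) (t : hom2 g h) (s : hom2 f g),
    fun2 (vcomp t s) = vcomp (fun2 t) (fun2 s);
  fun2_hcomp : forall x y z (g g' : hom1 y z) (f f' : hom1 x y)
      (t : hom2 g g') (s : hom2 f f'),
    fun2 (hcomp t s) ==2 hcomp (fun2 t) (fun2 s) }.

Arguments fun1 {S T} F {x y} f : rename.
Arguments fun2 {S T} F {x y f g} s : rename.

Program Definition twofun_id (T : twocat) : twofun T T :=
  @TwoFun _ _ (fun x => x) (fun _ _ f => f) (fun _ _ _ _ s => s) _ _ _ _ _.
Next Obligation. by []. Qed.
Next Obligation. by []. Qed.
Next Obligation. by []. Qed.
Next Obligation. by []. Qed.
Next Obligation. by move=> *; exact: cell_eq_refl. Qed.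

Program Definition twofun_comp (S T U : twocat) (F' : twofun T U)
    (F : twofun S T) : twofun S U :=
  @TwoFun _ _ (fun x => F' (F x)) (fun _ _ f => fun1 F' (fun1 F f))
    (fun _ _ _ _ s => fun2 F' (fun2 F s)) _ _ _ _ _.
Next Obligation. by move=> * /=; rewrite !fun1_id. Qed.
Next Obligation. by move=> * /=; rewrite !fun1_comp. Qed.
Next Obligation. by move=> * /=; rewrite !fun2_id. Qed.
Next Obligation. by move=> * /=; rewrite !fun2_vcomp. Qed.
Next Obligation.
move=> * /=; apply: cell_eq_trans; last exact: fun2_hcomp.
by case: fun2_hcomp; exact: cell_eq_refl.
Qed.

Section TwoNatural.
Context (S T : twocat).

Definition inverse2 (x y : T) (f g : hom1 x y) (s : hom2 f g) (t : hom2 g f) :=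
  vcomp t s = id2 f /\ vcomp s t = id2 g.

Definition is_iso2 (x y : T) (f g : hom1 x y) (s : hom2 f g) : Prop :=
  exists t, inverse2 s t.

Definition isomorphic1 (x y : T) (f g : hom1 x y) : Prop :=
  exists s : hom2 f g, is_iso2 s.

Definition is_equivalence1 (x y : T) (f : hom1 x y) : Prop :=
  exists g : hom1 y x,
    isomorphic1 (comp1 g f) (id1 x) /\ isomorphic1 (comp1 f g) (id1 y).

(* 2-natural transformations in the weak sense: the square of each 1-morphism
   commutes up to a chosen 2-isomorphism [nt2 f], compatibly with 2-morphisms. *)
Record twonat (F F' : twofun S T) := TwoNat {
  nt1 :> forall x, hom1 (F x) (F' x);
  nt2 : forall x y (f : hom1 x y),
    hom2 (comp1 (fun1 F' f) (nt1 x)) (comp1 (nt1 y) (fun1 F f));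
  nt2_iso : forall x y (f : hom1 x y), is_iso2 (nt2 f);
  nt2_nat : forall x y (f g : hom1 x y) (s : hom2 f g),
    vcomp (nt2 g) (hcomp (fun2 F' s) (id2 (nt1 x))) =
    vcomp (hcomp (id2 (nt1 y)) (fun2 F s)) (nt2 f) }.

(* All the squares commute on the nose, and the chosen 2-isomorphisms are
   identities; [nt2_nat] is then the strict compatibility with 2-morphisms. *)
Definition strictly_2natural (F F' : twofun S T) (t : twonat F F') : Prop :=
  forall x y (f : hom1 x y),
    comp1 (fun1 F' f) (t x) = comp1 (t y) (fun1 F f) /\
    nt2 t f ==2 id2 (comp1 (t y) (fun1 F f)).

Definition is_2natural_iso (F F' : twofun S T) (t : twonat F F') : Prop :=
  forall x, is_equivalence1 (t x).

Definition two_isomorphic (F F' : twofun S T) : Prop :=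
  exists t : twonat F F', is_2natural_iso t.

End TwoNatural.

Definition mutual_2quasi_inverses (S T : twocat) (F : twofun S T)
    (F' : twofun T S) : Prop :=
  two_isomorphic (twofun_comp F' F) (twofun_id S) /\
  two_isomorphic (twofun_comp F F') (twofun_id T).

Definition is_2equivalence (S T : twocat) (F : twofun S T) : Prop :=
  exists F' : twofun T S, mutual_2quasi_inverses F F'.

Definition two_equivalent (S T : twocat) : Prop :=
  exists F : twofun S T, is_2equivalence F.

(* Triangle identities: the pastings of unit and counit along the right and
   along the left adjoint are identities. *)
Definition pasting_right (S T : twocat) (L : twofun S T) (R : twofun T S)
    (eta : twonat (twofun_id S) (twofun_comp R L))
    (eps : twonat (twofun_comp L R) (twofun_id T)) : Prop :=
  forall B : T, comp1 (fun1 R (eps B)) (eta (R B)) = id1 (R B).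

Definition pasting_left (S T : twocat) (L : twofun S T) (R : twofun T S)
    (eta : twonat (twofun_id S) (twofun_comp R L))
    (eps : twonat (twofun_comp L R) (twofun_id T)) : Prop :=
  forall C : S, comp1 (eps (L C)) (fun1 L (eta C)) = id1 (L C).

Definition strictly_left_2adjoint (S T : twocat) (L : twofun S T)
    (R : twofun T S) (eta : twonat (twofun_id S) (twofun_comp R L))
    (eps : twonat (twofun_comp L R) (twofun_id T)) : Prop :=
  [/\ strictly_2natural eta, strictly_2natural eps,
      pasting_right eta eps & pasting_left eta eps].

Section GCategories.
Context (k : comPzRingType) (G : groupType).

(* By [act1] and [actM] each [act C a] is an automorphism, with inverse
   [act C a^-1]: this is a group homomorphism from G to Aut(C). *)
Record gcat := GCategory {
  gcat_cat :> kcat k;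
  act : G -> kfun gcat_cat gcat_cat;
  act1 : act 1%g = kid gcat_cat;
  actM : forall a b : G, act (a * b)%g = kcomp (act a) (act b) }.

Record eqfun (C D : gcat) := EqFun {
  efun :> kfun C D;
  rho : forall a : G, knat (kcomp (act D a) efun) (kcomp efun (act C a));
  rho_iso : forall a x, is_iso (rho a x);
  rhoM : forall (a b : G) (x : C),
    rho (b * a)%g x === rho b (act C a x) \c fmor (act D b) (rho a x) }.

Record eqnat (C D : gcat) (E E' : eqfun C D) := EqNat {
  enat :> knat E E';
  enatP : forall (a : G) (x : C),
    enat (act C a x) \c rho E a x = rho E' a x \c fmor (act D a) (enat x) }.

Definition strictly_equivariant (C D : gcat) (E : eqfun C D) : Prop :=
  forall a : G, kcomp (act D a) E = kcomp E (act C a) /\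
    forall x : C, rho E a x === idm (E (act C a x)).

Lemma act1o (C : gcat) (x : C) : act C 1%g x = x.
Proof. by rewrite act1. Qed.

Lemma actMo (C : gcat) a b (x : C) : act C (a * b)%g x = act C a (act C b x).
Proof. by rewrite actM. Qed.

Lemma heq_act1 (C : gcat) (x y : C) (f : hom C x y) : fmor (act C 1%g) f === f.
Proof. by rewrite act1; exact: hom_eq_refl. Qed.

Lemma heq_actM (C : gcat) a b (x y : C) (f : hom C x y) :
  fmor (act C (a * b)%g) f === fmor (act C a) (fmor (act C b) f).
Proof. by rewrite actM; exact: hom_eq_refl. Qed.

Lemma rho_nat (C D : gcat) (E : eqfun C D) a (x y : C) (f : hom C x y) :
  rho E a y \c fmor (act D a) (fmor E f) =
  fmor E (fmor (act C a) f) \c rho E a x.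
Proof. exact: (nnat (rho E a) f). Qed.

Lemma eqfun_ext (C D : gcat) (E E' : eqfun C D) : efun E = efun E' ->
  (forall a x, rho E a x === rho E' a x) -> E = E'.
Proof.
case: E E' => [E r i c] [E' r' i' c'] /= e rr'; subst E'.
have e : r = r'.
  apply: functional_extensionality_dep => a.
  by apply: knat_ext => x; exact/heq_eq/rr'.
by subst r'; f_equal; exact: Prop_irrelevance.
Qed.

Lemma eqnat_ext (C D : gcat) (E E' : eqfun C D) (s t : eqnat E E') :
  (forall x, s x = t x) -> s = t.
Proof.
case: s t => [s sP] [t tP] /= /knat_ext st; subst t.
by f_equal; exact: Prop_irrelevance.
Qed.

Lemma eqnat_cell_eq (C D : gcat) (E F E' F' : eqfun C D) (s : eqnat E F)
    (t : eqnat E' F') : E = E' -> F = F' -> (forall x, s x === t x) ->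
  cell_eq (K := @eqnat C D) s t.
Proof.
move=> e e'; subst E' F' => st.
suff -> : s = t by exact: cell_eq_refl.
by apply: eqnat_ext => x; exact/heq_eq/st.
Qed.

Program Definition eqfun_id (C : gcat) : eqfun C C :=
  @EqFun C C (kid C) (fun a => @KNat _ _ _ _ _ (fun x => idm (act C a x)) _) _ _.
Next Obligation. by move=> C a x y f /=; rewrite cmp1m cmpm1. Qed.
Next Obligation. by move=> C a x /=; exists (idm _); exact: inverses_id. Qed.
Next Obligation.
move=> C a b x /=; rewrite cmp1m fmor1.
by apply: heq_idm; exact: actMo.
Qed.

Program Definition eqfun_comp (C D D' : gcat) (E' : eqfun D D')
    (E : eqfun C D) : eqfun C D' :=
  @EqFun C D' (kcomp E' E)
    (fun a => @KNat _ _ _ _ _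
      (fun x => fmor E' (rho E a x) \c rho E' a (E x)) _) _ _.
Next Obligation.
move=> C D D' E' E a x y f /=.
rewrite -cmpA (nnat (rho E' a)) /= cmpA -fmorM (nnat (rho E a)) /=.
by rewrite fmorM -cmpA.
Qed.
Next Obligation.
move=> C D D' E' E a x /=.
have [g Hg] := rho_iso E a x; have [g' Hg'] := rho_iso E' a (E x).
exists (g' \c fmor E' g); apply: inverses_cmp => //.
exact: fmor_inverses.
Qed.
Next Obligation.
move=> C D D' E' E a b x /=.
apply: heq_trans (heq_cmp (heq_fmor E' (rhoM E a b x)) (rhoM E' a b (E x))) _.
apply: eq_heq; rewrite !fmorM -!cmpA; congr (_ \c _); rewrite !cmpA.
by rewrite (nnat (rho E' b)).
Qed.

Program Definition eqnat_id (C D : gcat) (E : eqfun C D) : eqnat E E :=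
  @EqNat _ _ _ _ (knat_id E) _.
Next Obligation. by move=> C D E a x /=; rewrite fmor1 cmp1m cmpm1. Qed.

Program Definition eqnat_vcomp (C D : gcat) (E E' E2 : eqfun C D)
    (t : eqnat E' E2) (s : eqnat E E') : eqnat E E2 :=
  @EqNat _ _ _ _ (knat_vcomp t s) _.
Next Obligation.
move=> C D E E' E2 t s a x /=.
by rewrite -cmpA enatP cmpA enatP -cmpA fmorM.
Qed.

Program Definition eqnat_hcomp (C D D' : gcat) (H H' : eqfun D D')
    (E E' : eqfun C D) (t : eqnat H H') (s : eqnat E E') :
    eqnat (eqfun_comp H E) (eqfun_comp H' E') :=
  @EqNat _ _ _ _ (knat_hcomp t s) _.
Next Obligation.
move=> C D D' H H' E E' t s a x /=.
rewrite cmpA -[t _ \c _ \c _]cmpA -fmorM enatP fmorM cmpA (nnat t) /=.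
rewrite -[_ \c _ \c rho H a _]cmpA enatP fmorM cmpA.
rewrite -[_ \c _ \c rho H' a _]cmpA -rho_nat -!cmpA.
by congr (_ \c (_ \c _)); rewrite /= -!fmorM (nnat t).
Qed.

Program Definition GCat : twocat :=
  @TwoCat gcat eqfun eqnat eqfun_id eqfun_comp eqnat_id eqnat_vcomp eqnat_hcomp
    _ _ _ _ _ _ _ _ _ _ _.
Next Obligation.
move=> C D E; apply: eqfun_ext.
  by apply: kfun_ext => // x y f; exact: hom_eq_refl.
by move=> a x /=; rewrite cmpm1; exact: hom_eq_refl.
Qed.
Next Obligation.
move=> C D E; apply: eqfun_ext.
  by apply: kfun_ext => // x y f; exact: hom_eq_refl.
by move=> a x /=; rewrite fmor1 cmp1m; exact: hom_eq_refl.
Qed.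
Next Obligation.
move=> C D D' D2 E2 E' E; apply: eqfun_ext.
  by apply: kfun_ext => // x y f; exact: hom_eq_refl.
by move=> a x /=; rewrite fmorM -cmpA; exact: hom_eq_refl.
Qed.
Next Obligation. by move=> C D E E' s; apply: eqnat_ext => x /=; rewrite cmp1m. Qed.
Next Obligation. by move=> C D E E' s; apply: eqnat_ext => x /=; rewrite cmpm1. Qed.
Next Obligation. by move=> *; apply: eqnat_ext => x /=; rewrite cmpA. Qed.
Next Obligation. by move=> *; apply: eqnat_ext => x /=; rewrite fmor1 cmp1m. Qed.
Next Obligation.
move=> C D D' H H' H2 E E' E2 t' t s' s; apply: eqnat_ext => x /=.
rewrite fmorM -!cmpA; congr (_ \c _); rewrite !cmpA; congr (_ \c _).
by rewrite (nnat t).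
Qed.
Next Obligation.
move=> C D E E' s; apply: eqnat_cell_eq; try exact: GCat_obligation_1.
by move=> x /=; rewrite cmp1m; exact: hom_eq_refl.
Qed.
Next Obligation.
move=> C D E E' s; apply: eqnat_cell_eq; try exact: GCat_obligation_2.
by move=> x /=; rewrite fmor1 cmpm1; exact: hom_eq_refl.
Qed.
Next Obligation.
move=> *; apply: eqnat_cell_eq; try exact: GCat_obligation_3.
by move=> x /=; rewrite fmorM cmpA; exact: hom_eq_refl.
Qed.

End GCategories.

Section GradedCategories.
Context (k : comPzRingType) (G : groupType).

(* [V] is the internal direct sum of the submodules [P a], [a : G]. *)
Definition direct_sum (V : lmodType k) (P : G -> set V) : Prop :=
  (forall a, P a 0 /\
    forall (t : k) (u v : V), P a u -> P a v -> P a (t *: u + v)) /\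
  forall v : V, exists! u : G -> V,
    [/\ forall a, P a (u a), finite_set [set a | u a <> 0] &
        v = \sum_(a \in [set: G]) u a].

Record grcat := GradedCategory {
  grcat_cat :> kcat k;
  deg : G -> forall x y : grcat_cat, set (hom grcat_cat x y);
  deg_direct_sum : forall x y, direct_sum (fun a => @deg a x y);
  deg_cmp : forall a b x y z (g : hom grcat_cat y z) (f : hom grcat_cat x y),
    deg b g -> deg a f -> deg (b * a)%g (g \c f) }.

Arguments deg B a {x y} f : rename.

Record degfun (B A : grcat) := DegFun {
  dfun :> kfun B A;
  adj : B -> G;
  adjP : forall a x y (f : hom B x y), deg B a f ->
    deg A ((adj y)^-1 * a * adj x)%g (fmor dfun f) }.

Record degnat (B A : grcat) (H I : degfun B A) := DegNat {
  dnat :> knat H I;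
  dnatP : forall x, deg A ((adj I x)^-1 * adj H x)%g (dnat x) }.

Definition strictly_degree_preserving (B A : grcat) (H : degfun B A) : Prop :=
  forall x : B, adj H x = 1%g.

Lemma deg0 (B : grcat) a (x y : B) : deg B a (0 : hom B x y).
Proof. by have [/(_ a)[]] := deg_direct_sum x y. Qed.

Lemma degZD (B : grcat) a (t : k) (x y : B) (f g : hom B x y) :
  deg B a f -> deg B a g -> deg B a (t *: f + g).
Proof. by have [/(_ a)[_ +] _] := deg_direct_sum x y; apply. Qed.

Lemma degD (B : grcat) a (x y : B) (f g : hom B x y) :
  deg B a f -> deg B a g -> deg B a (f + g).
Proof. by move=> fa ga; rewrite -[f]scale1r; exact: degZD. Qed.

Lemma degZ (B : grcat) a (t : k) (x y : B) (f : hom B x y) :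
  deg B a f -> deg B a (t *: f).
Proof. by move=> fa; rewrite -[_ *: _]addr0; apply: degZD => //; exact: deg0. Qed.

Lemma deg_fsum (B : grcat) (I : choiceType) a (x y : B) (u : I -> hom B x y) :
  (forall i, deg B a (u i)) -> deg B a (\sum_(i \in [set: I]) u i).
Proof.
move=> ua; elim: (finite_support _ _ _) => [|i s IH].
  by rewrite big_nil; exact: deg0.
by rewrite big_cons; exact: degD.
Qed.

Lemma fsumT (V : zmodType) (I : choiceType) (A : set I) (u : I -> V) :
  (forall i, ~ A i -> u i = 0) ->
  \sum_(i \in [set: I]) u i = \sum_(i \in A) u i.
Proof.
move=> uA; apply/esym/fsbig_widen => // i [_ nAi] /=.
exact: uA.
Qed.

Lemma fsum1 (V : zmodType) (I : choiceType) (j : I) (u : I -> V) :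
  (forall i, i <> j -> u i = 0) -> \sum_(i \in [set: I]) u i = u j.
Proof. by move=> uj; rewrite (@fsumT _ _ [set j]) // fsbig_set1. Qed.

Lemma fsum_morph (V W : zmodType) (I : choiceType) (A : set I) (h : V -> W)
    (u : I -> V) : finite_set A -> h 0 = 0 -> {morph h : x y / x + y} ->
  h (\sum_(i \in A) u i) = \sum_(i \in A) h (u i).
Proof.
by move=> fA h0 hD; rewrite !fsbig_finite // (big_morph h hD h0).
Qed.

Lemma homogeneous_uniq (B : grcat) (x y : B) (u v : G -> hom B x y) :
  (forall a, deg B a (u a)) -> (forall a, deg B a (v a)) ->
  finite_set [set a | u a <> 0] -> finite_set [set a | v a <> 0] ->
  \sum_(a \in [set: G]) u a = \sum_(a \in [set: G]) v a -> u = v.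
Proof.
move=> uP vP fu fv uv.
have [_ /(_ (\sum_(a \in [set: G]) u a)) [w [_ wu]]] := deg_direct_sum x y.
by rewrite -(wu u) // (wu v).
Qed.

Lemma deg_idm (B : grcat) (x : B) : deg B 1%g (idm x).
Proof.
have [_ /(_ (idm x)) [e [[eP fe eE] _]]] := deg_direct_sum x x.
suff e1 (f : hom B x x) : f \c e 1%g = f.
  by rewrite -(e1 (idm x)) cmp1m.
have e1h a (g : hom B x x) : deg B a g -> g \c e 1%g = g.
  move=> ga.
  pose u b := g \c e (a^-1 * b)%g.
  pose v b : hom B x x := if b == a then g else 0.
  suff : u a = v a by rewrite /u /v eqxx mulVg.
  congr (_ a); apply: homogeneous_uniq.
  - by move=> b; rewrite -{1}(mulVKg a b); exact: deg_cmp.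
  - by move=> b; rewrite /v; case: eqP => [->|_] //; exact: deg0.
  - have : finite_set ((fun b => a * b)%g @` [set b | e b <> 0]).
      exact: finite_image.
    apply: sub_finite_set => b /= ub; exists (a^-1 * b)%g; last exact: mulVKg.
    by move=> eb; apply: ub; rewrite /u eb cmpm0.
  - apply: sub_finite_set (finite_set1 a) => b /=; rewrite /v.
    by case: eqP.
  rewrite (@fsum1 _ _ a v) ?/v ?eqxx; last by move=> b /eqP/negPf ->.
  have -> : \sum_(b \in [set: G]) u b = \sum_(b \in [set: G]) (g \c e b).
    rewrite (reindex_fsbigT (fun b => a * b)%g) /=; last first.
      by exists (fun b => a^-1 * b)%g; [exact: mulKg | exact: mulVKg].
    by apply: eq_fsbigr => b _; rewrite /u mulKg.
  pose S := [set b | e b <> 0].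
  rewrite (@fsumT _ _ S); last first.
    by move=> b /contrapT ->; rewrite cmpm0.
  rewrite -(fsum_morph (h := fun f => g \c f)) //; first last.
  - by move=> f1 f2; rewrite cmpmD.
  - exact: cmpm0.
  by rewrite -fsumT -?eE ?cmpm1 // => b /contrapT.
have [_ /(_ f) [u [[uP fu fE] _]]] := deg_direct_sum x x.
rewrite fE (@fsumT _ _ [set b | u b <> 0]); last by move=> b /contrapT.
rewrite (fsum_morph (h := fun f => f \c e 1%g)) //.
- by apply: eq_fsbigr => b _; exact/e1h/uP.
- exact: cmp0m.
- by move=> g g'; rewrite cmpDm.
Qed.

Lemma degfun_ext (B A : grcat) (H I : degfun B A) : dfun H = dfun I ->
  (forall x, adj H x = adj I x) -> H = I.
Proof.
case: H I => [H r HP] [I s IP] /= e /funext e'; subst I s.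
by f_equal; exact: Prop_irrelevance.
Qed.

Lemma degnat_ext (B A : grcat) (H I : degfun B A) (s t : degnat H I) :
  (forall x, s x = t x) -> s = t.
Proof.
case: s t => [s sP] [t tP] /= /knat_ext st; subst t.
by f_equal; exact: Prop_irrelevance.
Qed.

Lemma degnat_cell_eq (B A : grcat) (H I H' I' : degfun B A) (s : degnat H I)
    (t : degnat H' I') : H = H' -> I = I' -> (forall x, s x === t x) ->
  cell_eq (K := @degnat B A) s t.
Proof.
move=> e e'; subst H' I' => st.
suff -> : s = t by exact: cell_eq_refl.
by apply: degnat_ext => x; exact/heq_eq/st.
Qed.

Program Definition degfun_id (B : grcat) : degfun B B :=
  @DegFun _ _ (kid B) (fun=> 1%g) _.
Next Obligation. by move=> B a x y f fa /=; rewrite invg1 mul1g mulg1. Qed.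

Program Definition degfun_comp (B A A' : grcat) (H' : degfun A A')
    (H : degfun B A) : degfun B A' :=
  @DegFun _ _ (kcomp H' H) (fun x => adj H x * adj H' (H x))%g _.
Next Obligation.
move=> B A A' H' H a x y f fa /=.
have := adjP (f := fmor H f) H' (adjP H fa).
by rewrite invgM !mulgA.
Qed.

Program Definition degnat_id (B A : grcat) (H : degfun B A) : degnat H H :=
  @DegNat _ _ _ _ (knat_id H) _.
Next Obligation. by move=> B A H x /=; rewrite mulVg; exact: deg_idm. Qed.

Program Definition degnat_vcomp (B A : grcat) (H I J : degfun B A)
    (t : degnat I J) (s : degnat H I) : degnat H J :=
  @DegNat _ _ _ _ (knat_vcomp t s) _.
Next Obligation.
move=> B A H I J t s x /=.
by have := deg_cmp (dnatP t x) (dnatP s x); rewrite mulgA mulgK.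
Qed.

Program Definition degnat_hcomp (B A A' : grcat) (H' I' : degfun A A')
    (H I : degfun B A) (t : degnat H' I') (s : degnat H I) :
    degnat (degfun_comp H' H) (degfun_comp I' I) :=
  @DegNat _ _ _ _ (knat_hcomp t s) _.
Next Obligation.
move=> B A A' H' I' H I t s x /=.
have := deg_cmp (dnatP t (I x)) (adjP H' (dnatP s x)).
by rewrite invgM !mulgA mulgK.
Qed.

Program Definition GGrCat : twocat :=
  @TwoCat grcat degfun degnat degfun_id degfun_comp degnat_id degnat_vcomp
    degnat_hcomp _ _ _ _ _ _ _ _ _ _ _.
Next Obligation.
move=> B A H; apply: degfun_ext; last by move=> x /=; rewrite mulg1.
by apply: kfun_ext => // x y f; exact: hom_eq_refl.
Qed.
Next Obligation.
move=> B A H; apply: degfun_ext; last by move=> x /=; rewrite mul1g.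
by apply: kfun_ext => // x y f; exact: hom_eq_refl.
Qed.
Next Obligation.
move=> B A A' A2 H2 H' H; apply: degfun_ext; last by move=> x /=; rewrite mulgA.
by apply: kfun_ext => // x y f; exact: hom_eq_refl.
Qed.
Next Obligation. by move=> *; apply: degnat_ext => x /=; rewrite cmp1m. Qed.
Next Obligation. by move=> *; apply: degnat_ext => x /=; rewrite cmpm1. Qed.
Next Obligation. by move=> *; apply: degnat_ext => x /=; rewrite cmpA. Qed.
Next Obligation. by move=> *; apply: degnat_ext => x /=; rewrite fmor1 cmp1m. Qed.
Next Obligation.
move=> B A A' H H' H2 E E' E2 t' t s' s; apply: degnat_ext => x /=.
rewrite fmorM -!cmpA; congr (_ \c _); rewrite !cmpA; congr (_ \c _).
by rewrite (nnat t).
Qed.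
Next Obligation.
move=> B A E E' s; apply: degnat_cell_eq; try exact: GGrCat_obligation_1.
by move=> x /=; rewrite cmp1m; exact: hom_eq_refl.
Qed.
Next Obligation.
move=> B A E E' s; apply: degnat_cell_eq; try exact: GGrCat_obligation_2.
by move=> x /=; rewrite fmor1 cmpm1; exact: hom_eq_refl.
Qed.
Next Obligation.
move=> *; apply: degnat_cell_eq; try exact: GGrCat_obligation_3.
by move=> x /=; rewrite fmorM cmpA; exact: hom_eq_refl.
Qed.

End GradedCategories.

Arguments deg {k G} B a {x y} f : rename.

Section OrbitCategory.
Context (k : comPzRingType) (G : groupType).
Implicit Type C : gcat k G.

(* [ent f b a] is the entry f_(b,a) : A_a x -> A_b y. *)
Record orbmat (C : gcat k G) (x y : C) := OrbMat {
  ent :> forall b a : G, hom C (act C a x) (act C b y);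
  ent_row_finite : forall b, finite_set [set a | ent b a <> 0];
  ent_col_finite : forall a, finite_set [set b | ent b a <> 0];
  ent_act : forall c b a,
    ent (c * b)%g (c * a)%g === fmor (act C c) (ent b a) }.

Lemma orbmat_ext C (x y : C) (f g : orbmat x y) :
  (forall b a, f b a = g b a) -> f = g.
Proof.
case: f g => [f fr fc fa] [g gr gc ga] /= fg.
have e : f = g by do 2 (apply: functional_extensionality_dep => ?); exact: fg.
by subst g; f_equal; exact: Prop_irrelevance.
Qed.

Program Definition orb0 C (x y : C) : orbmat x y :=
  @OrbMat C x y (fun _ _ => 0) _ _ _.
Next Obligation. by move=> C x y b; apply: sub_finite_set (finite_set0 G) => a. Qed.
Next Obligation. by move=> C x y b; apply: sub_finite_set (finite_set0 G) => a. Qed.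
Next Obligation.
by move=> C x y c b a; rewrite fmor0; apply: heq0; exact: actMo.
Qed.

Program Definition orbZD C (x y : C) (t : k) (f g : orbmat x y) : orbmat x y :=
  @OrbMat C x y (fun b a => t *: f b a + g b a) _ _ _.
Next Obligation.
move=> C x y t f g b.
have := conj (ent_row_finite f b) (ent_row_finite g b).
rewrite -finite_setU; apply: sub_finite_set.
move=> a /=; have [->|] := pselect (f b a = 0); last by left.
by rewrite scaler0 add0r; right.
Qed.
Next Obligation.
move=> C x y t f g a.
have := conj (ent_col_finite f a) (ent_col_finite g a).
rewrite -finite_setU; apply: sub_finite_set.
move=> b /=; have [->|] := pselect (f b a = 0); last by left.
by rewrite scaler0 add0r; right.
Qed.
Next Obligation.
move=> C x y t f g c b a; rewrite fmor_lin.
by apply: heqZD; exact: ent_act.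
Qed.

HB.instance Definition _ C (x y : C) := gen_eqMixin (orbmat x y).
HB.instance Definition _ C (x y : C) := gen_choiceMixin (orbmat x y).

Definition orbD C (x y : C) (f g : orbmat x y) := orbZD 1 f g.
Definition orbN C (x y : C) (f : orbmat x y) := orbZD (-1) f (orb0 x y).
Definition orbZ C (x y : C) (t : k) (f : orbmat x y) := orbZD t f (orb0 x y).

Fact orbDA C (x y : C) : associative (@orbD C x y).
Proof. by move=> f g h; apply: orbmat_ext => b a /=; rewrite !scale1r addrA. Qed.
Fact orbDC C (x y : C) : commutative (@orbD C x y).
Proof. by move=> f g; apply: orbmat_ext => b a /=; rewrite !scale1r addrC. Qed.
Fact orb0D C (x y : C) : left_id (@orb0 C x y) (@orbD C x y).
Proof. by move=> f; apply: orbmat_ext => b a /=; rewrite scale1r add0r. Qed.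
Fact orbND C (x y : C) : left_inverse (@orb0 C x y) (@orbN C x y) (@orbD C x y).
Proof.
by move=> f; apply: orbmat_ext => b a /=; rewrite scale1r scaleN1r addr0 addNr.
Qed.

HB.instance Definition _ C (x y : C) := GRing.isZmodule.Build (orbmat x y)
  (@orbDA C x y) (@orbDC C x y) (@orb0D C x y) (@orbND C x y).

Fact orbZA C (x y : C) s t (f : orbmat x y) : orbZ s (orbZ t f) = orbZ (s * t) f.
Proof. by apply: orbmat_ext => b a /=; rewrite !addr0 scalerA. Qed.
Fact orb1Z C (x y : C) : left_id 1 (@orbZ C x y).
Proof. by move=> f; apply: orbmat_ext => b a /=; rewrite addr0 scale1r. Qed.
Fact orbZDr C (x y : C) : right_distributive (@orbZ C x y) +%R.
Proof.
by move=> t f g; apply: orbmat_ext => b a /=; rewrite !addr0 !scale1r scalerDr.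
Qed.
Fact orbZDl C (x y : C) (f : orbmat x y) :
  {morph (@orbZ C x y)^~ f : s t / s + t}.
Proof.
by move=> s t; apply: orbmat_ext => b a /=; rewrite !addr0 !scale1r scalerDl.
Qed.

HB.instance Definition _ C (x y : C) :=
  GRing.Zmodule_isLmodule.Build k (orbmat x y)
    (@orbZA C x y) (@orb1Z C x y) (@orbZDr C x y) (@orbZDl C x y).

Lemma ent0 C (x y : C) b a : (0 : orbmat x y) b a = 0.
Proof. by []. Qed.

Lemma entD C (x y : C) (f g : orbmat x y) b a : (f + g) b a = f b a + g b a.
Proof. by rewrite -[in RHS](scale1r (f b a)). Qed.

Lemma entZ C (x y : C) t (f : orbmat x y) b a : (t *: f) b a = t *: f b a.
Proof. by rewrite -[RHS]addr0. Qed.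

Lemma entZD C (x y : C) t (f g : orbmat x y) b a :
  (t *: f + g) b a = t *: f b a + g b a.
Proof. by rewrite entD entZ. Qed.

Lemma ent_eq1 C (x y : C) (f : orbmat x y) b a :
  f b a === fmor (act C b) (f 1%g (b^-1 * a)%g).
Proof. by have := ent_act f b 1%g (b^-1 * a)%g; rewrite mulg1 mulVKg. Qed.

Lemma ent_eq0 C (x y : C) (f : orbmat x y) c b a :
  f b a = 0 -> f (c * b)%g (c * a)%g = 0.
Proof.
move=> f0; apply: heq_eq0 (heq_sym (ent_act f c b a)) _.
by rewrite f0 fmor0.
Qed.

Program Definition orb_cmp C (x y z : C) (g : orbmat y z) (f : orbmat x y) :
    orbmat x z :=
  @OrbMat C x z (fun b a => \sum_(c \in [set: G]) g b c \c f c a) _ _ _.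
Next Obligation.
move=> C x y z g f b.
have := @bigcup_finite _ _ [set c | g b c <> 0] (fun c => [set a | f c a <> 0])
  (ent_row_finite g b) (fun c _ => ent_row_finite f c).
apply: sub_finite_set => a /= s0; apply: contrapT => nex; apply: s0.
apply: fsbig1 => c _.
have [->|gc] := pselect (g b c = 0); first exact: cmp0m.
have [->|fc] := pselect (f c a = 0); first exact: cmpm0.
by case: nex; exists c.
Qed.
Next Obligation.
move=> C x y z g f a.
have := @bigcup_finite _ _ [set c | f c a <> 0] (fun c => [set b | g b c <> 0])
  (ent_col_finite f a) (fun c _ => ent_col_finite g c).
apply: sub_finite_set => b /= s0; apply: contrapT => nex; apply: s0.
apply: fsbig1 => c _.
have [->|gc] := pselect (g b c = 0); first exact: cmp0m.
have [->|fc] := pselect (f c a = 0); first exact: cmpm0.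
by case: nex; exists c.
Qed.
Next Obligation.
move=> C x y z g f d b a /=.
rewrite (reindex_fsbigT (fun c => d * c)%g) /=; last first.
  by exists (fun c => d^-1 * c)%g; [exact: mulKg | exact: mulVKg].
rewrite (@fsumT _ _ [set c | f c a <> 0] (fun c => g b c \c f c a)); last first.
  by move=> c /contrapT ->; rewrite cmpm0.
rewrite (fsum_morph (h := fun h => fmor (act C d) h)); last first.
- by move=> h h'; rewrite fmorD.
- exact: fmor0.
- exact: ent_col_finite.
rewrite -fsumT; last by move=> c /contrapT ->; rewrite cmpm0 fmor0.
apply: heq_fsum; try exact: actMo.
by move=> c; rewrite fmorM; apply: heq_cmp; exact: ent_act.
Qed.

(* P(f) = (delta_(a,b) A_a f)_(a,b): an entry with [e : a = b] is composed with
   the identity A_a y = A_b y. *)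
Definition orbP_ent C (x y : C) (f : hom C x y) (b a : G) :
    hom C (act C a x) (act C b y) :=
  match pselect (a = b) with
  | left e => idto (congr1 (fun c => act C c y) e) \c fmor (act C a) f
  | right _ => 0
  end.

(* (psi_c x) = (delta_(a,bc) id_(A_a x))_(a,b). *)
Definition orbpsi_ent C (c : G) (x : C) (b a : G) :
    hom C (act C a x) (act C b (act C c x)) :=
  match pselect (a = b * c)%g with
  | left e => idto (etrans (congr1 (fun d => act C d x) e) (actMo b c x))
  | right _ => 0
  end.

Lemma orbP_entE C (x y : C) (f : hom C x y) a :
  orbP_ent f a a = fmor (act C a) f.
Proof.
by rewrite /orbP_ent; case: pselect => // e; apply: heq_eq; exact: heq_idtol.
Qed.

Lemma orbP_entN C (x y : C) (f : hom C x y) b a : a <> b -> orbP_ent f b a = 0.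
Proof. by rewrite /orbP_ent; case: pselect. Qed.

Lemma orbpsi_entE C c (x : C) b :
  orbpsi_ent c x b (b * c)%g === idm (act C (b * c)%g x).
Proof. by rewrite /orbpsi_ent; case: pselect => // e; exact: heq_idto. Qed.

Lemma orbpsi_entE' C c (x : C) b :
  orbpsi_ent c x b (b * c)%g === idm (act C b (act C c x)).
Proof.
apply: heq_trans (orbpsi_entE c x b) _; apply: heq_idm; exact: actMo.
Qed.

Lemma orbpsi_entN C c (x : C) b a : a <> (b * c)%g -> orbpsi_ent c x b a = 0.
Proof. by rewrite /orbpsi_ent; case: pselect. Qed.

Program Definition orbP_mat C (x y : C) (f : hom C x y) : orbmat x y :=
  @OrbMat C x y (orbP_ent f) _ _ _.
Next Obligation.
move=> C x y f b; apply: sub_finite_set (finite_set1 b) => a /= ne.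
by apply: contrapT => ab; apply: ne; exact: orbP_entN.
Qed.
Next Obligation.
move=> C x y f a; apply: sub_finite_set (finite_set1 a) => b /= ne.
by apply: contrapT => ab; apply: ne; apply: orbP_entN => /esym.
Qed.
Next Obligation.
move=> C x y f c b a; have [->|ab] := pselect (a = b).
  by rewrite !orbP_entE; exact: heq_actM.
rewrite !orbP_entN //; last by move/mulgI.
by rewrite fmor0; apply: heq0; exact: actMo.
Qed.

Program Definition orbpsi_mat C (c : G) (x : C) : orbmat x (act C c x) :=
  @OrbMat C x (act C c x) (orbpsi_ent c x) _ _ _.
Next Obligation.
move=> C c x b; apply: sub_finite_set (finite_set1 (b * c)%g) => a /= ne.
by apply: contrapT => ab; apply: ne; exact: orbpsi_entN.
Qed.
Next Obligation.
move=> C c x a; apply: sub_finite_set (finite_set1 (a * c^-1)%g) => b /= ne.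
apply: contrapT => ab; apply: ne; apply: orbpsi_entN => abc; apply: ab.
by rewrite abc mulgK.
Qed.
Next Obligation.
move=> C c x d b a; have [->|ab] := pselect (a = b * c)%g; last first.
  rewrite !orbpsi_entN //; last by rewrite -mulgA => /mulgI.
  by rewrite fmor0; apply: heq0; exact: actMo.
have h1 := orbpsi_entE c x (d * b)%g.
have h2 := heq_fmor (act C d) (orbpsi_entE c x b).
rewrite mulgA; apply: (heq_trans h1); apply: heq_trans (heq_sym h2).
by rewrite fmor1; apply: heq_idm; rewrite -mulgA; exact: actMo.
Qed.

Program Definition orbit_cat C : kcat k :=
  @KCat k C (fun x y => orbmat x y) (fun x => orbP_mat (idm x)) (@orb_cmp C)
    _ _ _ _ _.
Next Obligation.
move=> C x y z f t g g'; apply: orbmat_ext => b a; rewrite entZD /=.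
have fA := ent_col_finite f a.
rewrite !(@fsumT _ _ [set c | f c a <> 0]); try by
  move=> c /contrapT ->; rewrite cmpm0.
rewrite !fsbig_finite // scaler_sumr -big_split /=.
by apply: eq_bigr => c _; rewrite -cmp_linl; congr (_ \c _); exact: entZD.
Qed.
Next Obligation.
move=> C x y z g t f f'; apply: orbmat_ext => b a; rewrite entZD /=.
have gA := ent_row_finite g b.
rewrite !(@fsumT _ _ [set c | g b c <> 0]); try by
  move=> c /contrapT ->; rewrite cmp0m.
rewrite !fsbig_finite // scaler_sumr -big_split /=.
by apply: eq_bigr => c _; rewrite -cmp_linr; congr (_ \c _); exact: entZD.
Qed.
Next Obligation.
move=> C x y f; apply: orbmat_ext => b a.
rewrite /orb_cmp [LHS]/= (@fsum1 _ _ b); last first.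
  by move=> c cb; rewrite orbP_entN // cmp0m.
by rewrite orbP_entE fmor1 cmp1m.
Qed.
Next Obligation.
move=> C x y f; apply: orbmat_ext => b a.
rewrite /orb_cmp [LHS]/= (@fsum1 _ _ a); last first.
  by move=> c ca; rewrite orbP_entN ?cmpm0 // => /esym.
by rewrite orbP_entE fmor1 cmpm1.
Qed.
Next Obligation.
move=> C x y z t h g f; apply: orbmat_ext => b a /=.
have fA := ent_col_finite f a; have hA := ent_row_finite h b.
set F := [set c | f c a <> 0] in fA; set H := [set c | h b c <> 0] in hA.
transitivity (\sum_(d \in H) \sum_(c \in F) h b d \c (g d c \c f c a)).
  rewrite (@fsumT _ _ H); last by move=> c /contrapT ->; rewrite cmp0m.
  apply: eq_fsbigr => d _.
  rewrite (@fsumT _ _ F); last by move=> c /contrapT ->; rewrite cmpm0.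
  rewrite (fsum_morph (h := fun u => h b d \c u)) //; first exact: cmpm0.
  by move=> u v; rewrite cmpmD.
rewrite exchange_fsbig // (@fsumT _ _ F); last first.
  by move=> c /contrapT ->; rewrite cmpm0.
apply: eq_fsbigr => c _.
rewrite (@fsumT _ _ H (fun d => h b d \c g d c)); last first.
  by move=> d /contrapT ->; rewrite cmp0m.
rewrite (fsum_morph (h := fun u => u \c f c a)) //; last first.
- by move=> u v; rewrite cmpDm.
- exact: cmp0m.
by apply: eq_fsbigr => d _; rewrite cmpA.
Qed.

Lemma ent_cmp C (x y z : orbit_cat C) (g : hom (orbit_cat C) y z)
    (f : hom (orbit_cat C) x y) b a :
  ent (g \c f) b a = \sum_(c \in [set: G]) ent g b c \c ent f c a.
Proof. by []. Qed.

Lemma ent_Pl C (x y z : C) (g : hom C y z) (f : hom (orbit_cat C) x y) b a :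
  ent ((orbP_mat g : hom (orbit_cat C) y z) \c f) b a =
  fmor (act C b) g \c ent f b a.
Proof.
rewrite ent_cmp (@fsum1 _ _ b) /= ?orbP_entE // => c cb.
by rewrite orbP_entN // cmp0m.
Qed.

Lemma ent_Pr C (x y z : C) (g : hom (orbit_cat C) y z) (f : hom C x y) b a :
  ent (g \c (orbP_mat f : hom (orbit_cat C) x y)) b a =
  ent g b a \c fmor (act C a) f.
Proof.
rewrite ent_cmp (@fsum1 _ _ a) /= ?orbP_entE // => c /nesym ac.
by rewrite orbP_entN // cmpm0.
Qed.

Program Definition orbP C : kfun C (orbit_cat C) :=
  @KFun _ C (orbit_cat C) (fun x => x) (fun x y f => orbP_mat f) _ _ _.
Next Obligation.
move=> C x y t f g; apply: orbmat_ext => b a; rewrite entZD.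
have [->|ab] := pselect (a = b).
  by rewrite /= !orbP_entE fmor_lin.
by rewrite /= !orbP_entN // scaler0 addr0.
Qed.
Next Obligation. by []. Qed.
Next Obligation.
move=> C x y z g f; apply: orbmat_ext => b a; rewrite ent_Pl.
have [->|ab] := pselect (a = b).
  by rewrite /= !orbP_entE fmorM.
by rewrite /= !orbP_entN // cmpm0.
Qed.

Program Definition orbpsi C (c : G) : knat (orbP C) (kcomp (orbP C) (act C c)) :=
  @KNat _ C (orbit_cat C) _ _ (fun x => orbpsi_mat c x) _.
Next Obligation.
move=> C c x y f; apply: orbmat_ext => b a.
apply: etrans (ent_Pr (orbpsi_mat c y : hom (orbit_cat C) _ _) f b a) _.
apply: etrans (esym (ent_Pl (fmor (act C c) f)
  (orbpsi_mat c x : hom (orbit_cat C) _ _) b a)).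
rewrite /=; have [->|ab] := pselect (a = b * c)%g; last first.
  by rewrite !orbpsi_entN // cmp0m cmpm0.
apply: heq_eq; apply: heq_trans (heq_cmp (orbpsi_entE c y b) (hom_eq_refl _)) _.
rewrite cmp1m; apply: heq_trans (heq_actM b c f) _; apply: heq_sym.
apply: heq_trans (heq_cmp (hom_eq_refl _) _) _; last 1 first.
- by apply: eq_heq; exact: cmpm1.
apply: heq_trans (orbpsi_entE c x b) _; apply: heq_idm; exact: actMo.
Qed.

(* The image of C(A_a x, y) under P^(1), i.e. of f |-> P(f) psi_a x. *)
Definition orbit_deg C (a : G) (x y : orbit_cat C) : set (hom (orbit_cat C) x y) :=
  [set h | exists f : hom C (act C a x) y, h = fmor (orbP C) f \c orbpsi C a x].

Lemma orbit_degE C a (x y : orbit_cat C) (h : hom (orbit_cat C) x y) :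
  orbit_deg a h <-> forall b c, c <> (b * a)%g -> ent h b c = 0.
Proof.
split=> [[f ->] b c cba|h0].
  by rewrite ent_Pl /= orbpsi_entN // cmpm0.
exists (idto (act1o y) \c ent h 1%g a); apply: orbmat_ext => b c.
rewrite ent_Pl /=; have [->|cba] := pselect (c = b * a)%g; last first.
  by rewrite orbpsi_entN // cmpm0; exact: h0.
apply: heq_eq; have := ent_act h b 1%g a; rewrite mulg1 => /heq_trans; apply.
apply: (@heq_trans _ _ _ _ _ _ _ _ _
  (fmor (act C b) (idto (act1o y) \c ent h 1%g a) \c idm _)).
  by rewrite cmpm1; apply: heq_fmor; exact/heq_sym/heq_idtol.
apply: heq_cmp; first exact: hom_eq_refl.
apply: heq_sym; apply: heq_trans (orbpsi_entE a x b) _.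
by apply: heq_idm; exact: actMo.
Qed.

Lemma orbit_deg_cmp C a b (x y z : orbit_cat C) (g : hom (orbit_cat C) y z)
    (f : hom (orbit_cat C) x y) :
  orbit_deg b g -> orbit_deg a f -> orbit_deg (b * a)%g (g \c f).
Proof.
move=> /orbit_degE gb /orbit_degE fa; apply/orbit_degE => d c cdba.
rewrite ent_cmp; apply: fsbig1 => e _.
have [edb|edb] := pselect (e = d * b)%g; last by rewrite gb // cmp0m.
by rewrite fa ?cmpm0 // edb -mulgA.
Qed.

Program Definition orbit_part C (x y : C) (h : orbmat x y) (a : G) : orbmat x y :=
  @OrbMat C x y (fun b c => if c == (b * a)%g then ent h b c else 0) _ _ _.
Next Obligation.
move=> C x y h a b; apply: sub_finite_set (ent_row_finite h b) => c /=.
by case: eqP.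
Qed.
Next Obligation.
move=> C x y h a c; apply: sub_finite_set (ent_col_finite h c) => b /=.
by case: eqP.
Qed.
Next Obligation.
move=> C x y h a d b c; have [->|cba] := eqVneq c (b * a)%g.
  by rewrite mulgA eqxx; have := ent_act h d b (b * a)%g; rewrite mulgA.
rewrite ifF; last by apply/eqP; rewrite -mulgA => /mulgI/eqP; exact/negP.
by rewrite fmor0; apply: heq0; exact: actMo.
Qed.

Lemma ent_fsum C (x y : orbit_cat C) (u : G -> hom (orbit_cat C) x y) b c :
  (forall a, orbit_deg a (u a)) -> finite_set [set a | u a <> 0] ->
  ent (\sum_(a \in [set: G]) u a) b c = ent (u (b^-1 * c)%g) b c.
Proof.
move=> ud uf; rewrite (@fsumT _ _ [set a | u a <> 0]); last by move=> a /contrapT.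
rewrite (fsum_morph (h := fun v => @ent C x y v b c)) //; last first.
  by move=> v w; exact: entD.
rewrite -fsumT; last by move=> a /contrapT ->.
apply: fsum1 => a ane; have /orbit_degE := ud a; apply => cba.
by apply: ane; rewrite cba mulKg.
Qed.

Lemma orbit_direct_sum C (x y : orbit_cat C) :
  direct_sum (fun a => @orbit_deg C a x y).
Proof.
split=> [a|h].
  split=> [|t f g /orbit_degE fa /orbit_degE ga]; apply/orbit_degE => // b c cba.
  by rewrite [LHS](entZD t f g) fa // ga // scaler0 addr0.
pose u a : hom (orbit_cat C) x y := orbit_part h a.
have ud a : orbit_deg a (u a).
  by apply/orbit_degE => b c /= /eqP/negPf ->.
have uf : finite_set [set a | u a <> 0].
  apply: sub_finite_set (ent_row_finite h 1%g) => a /= ua h0; apply: ua.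
  apply: orbmat_ext => b c /=; case: eqP => // ->.
  by have := ent_eq0 b h0; rewrite mulg1.
exists u; split=> [|w [wd wf hw]].
  split=> //; apply: orbmat_ext => b c.
  by rewrite ent_fsum //= mulVKg eqxx.
apply/funext => a; apply: orbmat_ext => b c /=; case: eqP => [->|cba].
  by rewrite hw ent_fsum // mulKg.
by have /orbit_degE -> := wd a.
Qed.

Definition orbit C : grcat k G :=
  @GradedCategory k G (orbit_cat C) (@orbit_deg C) (@orbit_direct_sum C)
    (@orbit_deg_cmp C).

End OrbitCategory.

Section OrbitFunctor.
Context (k : comPzRingType) (G : groupType).
Implicit Types C D : gcat k G.

(* Entries of H(h): A_a (E x) -> E (A_a x) -> E (A_b y) -> A_b (E y).
   By [orbH_P], [orbH_psi] and [orbH_unique] below, H is the unique functor with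
   H P = P' E and H psi_a = (P' rho_a) (psi'_a E). *)
Definition orbH_ent C D (E : eqfun C D) (x y : C) (h : orbmat x y) (b a : G) :
    hom D (act D a (E x)) (act D b (E y)) :=
  invm (rho_iso E b y) \c fmor E (ent h b a) \c rho E a x.

Lemma orbH_ent0 C D (E : eqfun C D) (x y : C) (h : orbmat x y) b a :
  ent h b a = 0 -> orbH_ent E h b a = 0.
Proof. by rewrite /orbH_ent => ->; rewrite fmor0 cmpm0 cmp0m. Qed.

Program Definition orbH_mat C D (E : eqfun C D) (x y : C) (h : orbmat x y) :
    @orbmat k G D (E x) (E y) :=
  @OrbMat k G D (E x) (E y) (orbH_ent E h) _ _ _.
Next Obligation.
move=> C D E x y h b; apply: sub_finite_set (ent_row_finite h b) => a /= ne h0.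
by apply: ne; exact: orbH_ent0.
Qed.
Next Obligation.
move=> C D E x y h a; apply: sub_finite_set (ent_col_finite h a) => b /= ne h0.
by apply: ne; exact: orbH_ent0.
Qed.
Next Obligation.
move=> C D E x y h c b a; rewrite /orbH_ent.
pose ib := invm (rho_iso E b y); pose ic := invm (rho_iso E c (act C b y)).
have Hb : inverses (rho E b y) ib by exact: invmP.
have Hc : inverses (rho E c (act C b y)) ic by exact: invmP.
have inv_cb : invm (rho_iso E (c * b)%g y) === fmor (act D c) ib \c ic.
  apply: heq_inverses (rhoM E b c y); first exact: invmP.
  by apply: inverses_cmp => //; exact: fmor_inverses.
apply: heq_trans (heq_cmp (heq_cmp inv_cb (heq_fmor E (ent_act h c b a)))
  (rhoM E a c x)) _.
apply: eq_heq; rewrite !fmorM -/ib.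
have e : ic \c fmor E (fmor (act C c) (ent h b a)) \c rho E c (act C a x) =
    fmor (act D c) (fmor E (ent h b a)).
  by rewrite -cmpA -rho_nat cmpA /= (proj1 Hc) cmp1m.
by rewrite -e !cmpA.
Qed.

Program Definition orbH C D (E : eqfun C D) : kfun (orbit_cat C) (orbit_cat D) :=
  @KFun _ (orbit_cat C) (orbit_cat D) E (fun x y h => orbH_mat E h) _ _ _.
Next Obligation.
move=> C D E x y t f g; apply: orbmat_ext => b a; rewrite entZD.
by rewrite /= /orbH_ent [ent (_ *: _ + _) _ _]entZD fmor_lin cmp_linr cmp_linl.
Qed.
Next Obligation.
move=> C D E x; apply: orbmat_ext => b a /=.
have [->|ab] := pselect (a = b); last first.
  by rewrite orbP_entN // orbH_ent0 //= orbP_entN.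
rewrite orbP_entE /orbH_ent /= orbP_entE !fmor1 cmpm1.
by rewrite (proj1 (invmP _)).
Qed.
Next Obligation.
move=> C D E x y z g f; apply: orbmat_ext => b a; rewrite ent_cmp /=.
have fA := ent_col_finite f a.
rewrite /orbH_ent ent_cmp (@fsumT _ _ [set c | ent f c a <> 0]); last first.
  by move=> c /contrapT ->; rewrite cmpm0.
rewrite (fsum_morph (h := fmor E)) //; first last.
- by move=> u v; exact: fmorD.
- exact: fmor0.
rewrite (fsum_morph (h := fun u => invm (rho_iso E b z) \c u)) //; first last.
- by move=> u v; exact: cmpmD.
- exact: cmpm0.
rewrite (fsum_morph (h := fun u => u \c rho E a x)) //; first last.
- by move=> u v; exact: cmpDm.
- exact: cmp0m.
rewrite [RHS](@fsumT _ _ [set c | ent f c a <> 0]); last first.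
  by move=> c /contrapT ->; rewrite fmor0 cmpm0 cmp0m cmpm0.
apply: eq_fsbigr => c _.
rewrite fmorM !cmpA -[_ \c rho E c y \c _]cmpA.
by rewrite (proj2 (invmP (rho_iso E c y))) cmpm1.
Qed.

Lemma orbH_P C D (E : eqfun C D) : kcomp (orbH E) (orbP C) = kcomp (orbP D) E.
Proof.
apply: kfun_ext => // x y f; apply: eq_heq; apply: orbmat_ext => b a /=.
have [->|ab] := pselect (a = b); last first.
  by rewrite orbP_entN // orbH_ent0 //= orbP_entN.
rewrite orbP_entE /orbH_ent /= orbP_entE -cmpA -rho_nat cmpA.
by rewrite (proj1 (invmP (rho_iso E b y))) cmp1m.
Qed.

Lemma orbH_psi C D (E : eqfun C D) a (x : C) :
  fmor (orbH E) (orbpsi C a x) = fmor (orbP D) (rho E a x) \c orbpsi D a (E x).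
Proof.
apply: orbmat_ext => b c; apply: etrans (esym (ent_Pl (rho E a x)
  (orbpsi_mat a (E x) : hom (orbit_cat D) _ _) b c)).
rewrite /=; have [->|cba] := pselect (c = b * a)%g; last first.
  by rewrite orbpsi_entN // cmpm0 orbH_ent0 //= orbpsi_entN.
apply: heq_eq; rewrite /orbH_ent /=.
pose ib := invm (rho_iso E b (act C a x)).
have Hb : inverses (rho E b (act C a x)) ib by exact: invmP.
apply: (@heq_trans _ _ _ _ _ _ _ _ _ (ib \c idm _ \c
  (rho E b (act C a x) \c fmor (act D b) (rho E a x)))).
  apply: heq_cmp (rhoM E a b x); apply: heq_cmp; first exact: hom_eq_refl.
  apply: heq_trans (heq_fmor E (orbpsi_entE a x b)) _; rewrite fmor1.
  by apply: heq_idm; rewrite /= actMo.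
rewrite cmpm1 cmpA (proj1 Hb) cmp1m; apply: heq_sym.
apply: heq_trans (heq_cmp (hom_eq_refl _) (orbpsi_entE' a (E x) b)) _.
by rewrite /= cmpm1; exact: hom_eq_refl.
Qed.

Lemma orbH_unique C D (E : eqfun C D) (F : kfun (orbit_cat C) (orbit_cat D)) :
  kcomp F (orbP C) = kcomp (orbP D) E ->
  (forall a (x : C), fmor F (orbpsi C a x) ===
     fmor (orbP D) (rho E a x) \c orbpsi D a (E x)) ->
  F = orbH E.
Proof.
move=> FP Fpsi; have FE (x : C) : F x = E x.
  exact: (congr1 (fun F' : kfun C (orbit_cat D) => F' x) FP).
apply: kfun_ext => // x y h.
have [_ /(_ h) [u [[ud uf ->] _]]] := orbit_direct_sum x y.
set S := [set a | u a <> 0] in uf.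
have FH a : fmor F (u a) === fmor (orbH E) (u a).
  have [f ->] := ud a; rewrite !fmorM orbH_psi.
  apply: heq_cmp (Fpsi a x).
  apply: heq_trans (_ : fmor (kcomp F (orbP C)) f === _) _.
    exact: heq_fun FP.
  by rewrite -orbH_P; exact: hom_eq_refl.
rewrite (@fsumT _ _ S); last by move=> a /contrapT.
rewrite (fsum_morph (h := fmor F)) //; [|exact: fmor0|exact: fmorD].
rewrite (fsum_morph (h := fmor (orbH E))) //; [|exact: fmor0|exact: fmorD].
rewrite -(@fsumT _ _ S (fun a => fmor F (u a))); last first.
  by move=> a /contrapT ->; rewrite fmor0.
rewrite -(@fsumT _ _ S (fun a => fmor (orbH E) (u a))); last first.
  by move=> a /contrapT ->; rewrite fmor0.
by apply: heq_fsum; try exact: FE.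
Qed.

Program Definition orbit1 C D (E : eqfun C D) : degfun (orbit C) (orbit D) :=
  @DegFun k G (orbit C) (orbit D) (orbH E) (fun=> 1%g) _.
Next Obligation.
move=> C D E a x y f; rewrite invg1 mul1g mulg1 => /orbit_degE fa.
by apply/orbit_degE => b c cba; apply: orbH_ent0; exact: fa.
Qed.

Program Definition orbit2 C D (E E' : eqfun C D) (s : eqnat E E') :
    degnat (orbit1 E) (orbit1 E') :=
  @DegNat k G (orbit C) (orbit D) _ _
    (@KNat _ _ _ (orbH E) (orbH E') (fun x => fmor (orbP D) (s x)) _) _.
Next Obligation.
move=> C D E E' s x y h; apply: orbmat_ext => b a.
apply: etrans (ent_Pl (s y) (orbH_mat E h : hom (orbit_cat D) _ _) b a) _.
apply: etrans (esym (ent_Pr (orbH_mat E' h : hom (orbit_cat D) _ _) (s x) b a)).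
have /= ea := enatP s a x; have /= eb := enatP s b y.
rewrite /= /orbH_ent -[RHS]cmpA -ea.
have e : invm (rho_iso E' b y) \c s (act C b y) =
    fmor (act D b) (s y) \c invm (rho_iso E b y).
  rewrite -[LHS]cmpm1 -(proj2 (invmP (rho_iso E b y))) /= cmpA.
  rewrite -[_ \c _ \c rho E b y]cmpA eb cmpA.
  by rewrite (proj1 (invmP (rho_iso E' b y))) cmp1m.
by rewrite !cmpA -e -[_ \c s _ \c fmor E _]cmpA nnat cmpA.
Qed.
Next Obligation.
move=> C D E E' s x; rewrite /= invg1 mul1g.
apply/orbit_degE => b c; rewrite mulg1 => cb; exact: orbP_entN.
Qed.

Program Definition orbit_2fun : twofun (GCat k G) (GGrCat k G) :=
  @TwoFun (GCat k G) (GGrCat k G) (@orbit k G) orbit1 orbit2 _ _ _ _ _.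
Next Obligation.
move=> C; apply: degfun_ext => //=; apply: kfun_ext => // x y h.
apply: eq_heq; apply: orbmat_ext => b a; rewrite /= /orbH_ent /= cmpm1.
by have [/= e _] := invmP (rho_iso (eqfun_id C) b y); rewrite cmpm1 in e; rewrite e cmp1m.
Qed.
Next Obligation.
move=> C D D' E' E; apply: degfun_ext => /= [|x]; last by rewrite mulg1.
apply: kfun_ext => // x y h; apply: eq_heq; apply: orbmat_ext => b a.
rewrite /= /orbH_ent /=.
have e : invm (rho_iso (eqfun_comp E' E) b y) =
    invm (rho_iso E' b (E y)) \c fmor E' (invm (rho_iso E b y)).
  apply: heq_eq; apply: (heq_inverses (invmP _)); last exact: hom_eq_refl.
  by apply: inverses_cmp; [exact: invmP | apply: fmor_inverses; exact: invmP].
by rewrite e /= !fmorM !cmpA.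
Qed.
Next Obligation. by move=> C D E; apply: degnat_ext. Qed.
Next Obligation.
move=> C D E E' E2 t s; apply: degnat_ext => x.
exact: (fmorM (orbP D)).
Qed.
Next Obligation.
move=> C D D' H H' E E' t s.
apply: degnat_cell_eq; try exact: orbit_2fun_obligation_2.
move=> x; apply: eq_heq; rewrite [LHS](fmorM (orbP D')); congr (_ \c _).
apply/esym; apply: heq_eq.
by apply: heq_trans (heq_fun (s x) (orbH_P H)) _; exact: hom_eq_refl.
Qed.

End OrbitFunctor.

Section SmashProduct.
Context (k : comPzRingType) (G : groupType).
Implicit Types B A : grcat k G.

(* The homogeneous component B^d(x, y), as a module. *)
Record degmor (B : grcat k G) (d : G) (x y : B) := DegMor {
  dval :> hom B x y;
  dvalP : deg B d dval }.

Lemma degmor_ext B d (x y : B) (f g : degmor d x y) : dval f = dval g -> f = g.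
Proof.
case: f g => [f fP] [g gP] /= e; subst g.
by f_equal; exact: Prop_irrelevance.
Qed.

HB.instance Definition _ B d (x y : B) := gen_eqMixin (degmor d x y).
HB.instance Definition _ B d (x y : B) := gen_choiceMixin (degmor d x y).

Definition dzero B d (x y : B) : degmor d x y := DegMor (deg0 d x y).
Definition dadd B d (x y : B) (f g : degmor d x y) : degmor d x y :=
  DegMor (degD (dvalP f) (dvalP g)).
Definition dscale B d (x y : B) (t : k) (f : degmor d x y) : degmor d x y :=
  DegMor (degZ t (dvalP f)).
Definition dopp B d (x y : B) (f : degmor d x y) := dscale (-1) f.

Fact daddA B d (x y : B) : associative (@dadd B d x y).
Proof. by move=> f g h; apply: degmor_ext => /=; rewrite addrA. Qed.
Fact daddC B d (x y : B) : commutative (@dadd B d x y).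
Proof. by move=> f g; apply: degmor_ext => /=; rewrite addrC. Qed.
Fact dadd0 B d (x y : B) : left_id (@dzero B d x y) (@dadd B d x y).
Proof. by move=> f; apply: degmor_ext => /=; rewrite add0r. Qed.
Fact daddN B d (x y : B) :
  left_inverse (@dzero B d x y) (@dopp B d x y) (@dadd B d x y).
Proof. by move=> f; apply: degmor_ext => /=; rewrite scaleN1r addNr. Qed.

HB.instance Definition _ B d (x y : B) := GRing.isZmodule.Build (degmor d x y)
  (@daddA B d x y) (@daddC B d x y) (@dadd0 B d x y) (@daddN B d x y).

Fact dscaleA B d (x y : B) s t (f : degmor d x y) :
  dscale s (dscale t f) = dscale (s * t) f.
Proof. by apply: degmor_ext => /=; rewrite scalerA. Qed.
Fact dscale1 B d (x y : B) : left_id 1 (@dscale B d x y).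
Proof. by move=> f; apply: degmor_ext => /=; rewrite scale1r. Qed.
Fact dscaleDr B d (x y : B) : right_distributive (@dscale B d x y) +%R.
Proof. by move=> t f g; apply: degmor_ext => /=; rewrite scalerDr. Qed.
Fact dscaleDl B d (x y : B) (f : degmor d x y) :
  {morph (@dscale B d x y)^~ f : s t / s + t}.
Proof. by move=> s t; apply: degmor_ext => /=; rewrite scalerDl. Qed.

HB.instance Definition _ B d (x y : B) :=
  GRing.Zmodule_isLmodule.Build k (degmor d x y)
    (@dscaleA B d x y) (@dscale1 B d x y) (@dscaleDr B d x y) (@dscaleDl B d x y).

Lemma dvalZD B d (x y : B) t (f g : degmor d x y) :
  dval (t *: f + g) = t *: dval f + dval g.
Proof. by []. Qed.

(* The object x^(a) is the pair (x, a). *)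
Definition smash_hom B (p q : B * G) : lmodType k :=
  degmor (q.2^-1 * p.2)%g p.1 q.1.

Program Definition smash_idm B (p : B * G) : smash_hom p p :=
  @DegMor _ _ _ _ (idm p.1) _.
Next Obligation. by move=> B p; rewrite mulVg; exact: deg_idm. Qed.

Program Definition smash_cmp B (p q r : B * G) (g : smash_hom q r)
    (f : smash_hom p q) : smash_hom p r :=
  @DegMor _ _ _ _ (dval g \c dval f) _.
Next Obligation.
move=> B p q r g f; have := deg_cmp (dvalP g) (dvalP f).
by rewrite mulgA mulgK.
Qed.

Program Definition smash_cat B : kcat k :=
  @KCat k (B * G)%type (@smash_hom B) (@smash_idm B) (@smash_cmp B) _ _ _ _ _.
Next Obligation.
by move=> B p q r f t g g'; apply: degmor_ext; rewrite /= cmp_linl.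
Qed.
Next Obligation.
by move=> B p q r g t f f'; apply: degmor_ext; rewrite /= cmp_linr.
Qed.
Next Obligation. by move=> *; apply: degmor_ext; rewrite /= cmp1m. Qed.
Next Obligation. by move=> *; apply: degmor_ext; rewrite /= cmpm1. Qed.
Next Obligation. by move=> *; apply: degmor_ext; rewrite /= cmpA. Qed.

Lemma smash_heq B (p q p' q' : smash_cat B) (f : hom (smash_cat B) p q)
    (f' : hom (smash_cat B) p' q') :
  p = p' -> q = q' -> dval f === dval f' -> f === f'.
Proof.
move=> e e'; subst p' q' => ff'; apply: eq_heq; apply: degmor_ext.
exact: heq_eq.
Qed.

Program Definition smash_act B (c : G) : kfun (smash_cat B) (smash_cat B) :=
  @KFun _ (smash_cat B) (smash_cat B) (fun p => (p.1, c * p.2)%g)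
    (fun p q f => @DegMor _ _ _ _ (dval f) _) _ _ _.
Next Obligation.
by move=> B c p q f; have := dvalP f; rewrite /= invgM -mulgA mulKg.
Qed.
Next Obligation. by move=> B c p q t f g; exact: degmor_ext. Qed.
Next Obligation. by move=> B c p; exact: degmor_ext. Qed.
Next Obligation. by move=> B c p q r g f; exact: degmor_ext. Qed.

Program Definition smash B : gcat k G :=
  @GCategory k G (smash_cat B) (smash_act B) _ _.
Next Obligation.
move=> B; have e (p : B * G) : (p.1, 1 * p.2)%g = p.
  by rewrite mul1g -surjective_pairing.
apply: kfun_ext => // p q f; apply: smash_heq; try exact: e.
exact: hom_eq_refl.
Qed.
Next Obligation.
move=> B a b; have e (p : B * G) : (p.1, (a * b) * p.2)%g = (p.1, a * (b * p.2))%g.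
  by rewrite mulgA.
apply: kfun_ext => // p q f; apply: smash_heq; try exact: e.
exact: hom_eq_refl.
Qed.

Program Definition smashH B A (H : degfun B A) :
    kfun (smash_cat B) (smash_cat A) :=
  @KFun _ (smash_cat B) (smash_cat A) (fun p => (H p.1, p.2 * adj H p.1)%g)
    (fun p q f => @DegMor _ _ _ _ (fmor H (dval f)) _) _ _ _.
Next Obligation.
by move=> B A H p q f; have := adjP H (dvalP f); rewrite /= invgM !mulgA.
Qed.
Next Obligation.
by move=> B A H p q t f g; apply: degmor_ext; rewrite /= fmor_lin.
Qed.
Next Obligation. by move=> B A H p; apply: degmor_ext; rewrite /= fmor1. Qed.
Next Obligation.
by move=> B A H p q r g f; apply: degmor_ext; rewrite /= fmorM.
Qed.

(* The 2-cells A_c (H#G) => (H#G) A_c are identities of B#G: see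
   [smash1_strict]. *)
Program Definition smash1 B A (H : degfun B A) : eqfun (smash B) (smash A) :=
  @EqFun k G (smash B) (smash A) (smashH H)
    (fun c => @KNat _ _ _ _ _ (fun p => @DegMor _ _ _ _ (idm (H p.1)) _) _) _ _.
Next Obligation.
by move=> B A H c p /=; rewrite -mulgA mulVg; exact: deg_idm.
Qed.
Next Obligation.
by move=> B A H c p q f; apply: degmor_ext; rewrite /= cmp1m cmpm1.
Qed.
Next Obligation.
move=> B A H c p.
have d : deg A ((c * (p.2 * adj H p.1))^-1 * (c * p.2 * adj H p.1))%g
    (idm (H p.1)).
  by rewrite -!mulgA mulVg; exact: deg_idm.
by exists (DegMor d); split; apply: degmor_ext; rewrite /= cmp1m.
Qed.
Next Obligation.
move=> B A H a b p; apply: smash_heq; try by rewrite /= !mulgA.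
by rewrite /= cmp1m; exact: hom_eq_refl.
Qed.

Lemma smash1_strict B A (H : degfun B A) : strictly_equivariant (smash1 H).
Proof.
move=> c; have e (p : B * G) :
    (H p.1, c * (p.2 * adj H p.1))%g = (H p.1, c * p.2 * adj H p.1)%g.
  by rewrite mulgA.
split.
  apply: kfun_ext => // p q f; apply: smash_heq; try exact: e.
  exact: hom_eq_refl.
by move=> p; apply: smash_heq; [exact: e|by []|exact: hom_eq_refl].
Qed.

Program Definition smash2 B A (H I : degfun B A) (s : degnat H I) :
    eqnat (smash1 H) (smash1 I) :=
  @EqNat k G (smash B) (smash A) (smash1 H) (smash1 I)
    (@KNat _ _ _ (smashH H) (smashH I)
      (fun p => @DegMor _ _ _ _ (s p.1) _) _) _.
Next Obligation.
move=> B A H I s p; have := dnatP s p.1.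
by rewrite /= invgM -!mulgA mulKg.
Qed.
Next Obligation. by move=> B A H I s p q f; apply: degmor_ext; exact: nnat. Qed.
Next Obligation.
by move=> B A H I s c p; apply: degmor_ext; rewrite /= cmp1m cmpm1.
Qed.

Program Definition smash_2fun : twofun (GGrCat k G) (GCat k G) :=
  @TwoFun (GGrCat k G) (GCat k G) smash smash1 smash2 _ _ _ _ _.
Next Obligation.
move=> B; have e (p : B * G) : (p.1, p.2 * 1)%g = p.
  by rewrite mulg1 -surjective_pairing.
apply: eqfun_ext.
  apply: kfun_ext => // p q f; apply: smash_heq; try exact: e.
  exact: hom_eq_refl.
by move=> c p; apply: smash_heq; rewrite /= ?mulg1 -?surjective_pairing.
Qed.
Next Obligation.
move=> B A A' H' H; have e (p : B * G) :
    (H' (H p.1), p.2 * (adj H p.1 * adj H' (H p.1)))%g =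
    (H' (H p.1), p.2 * adj H p.1 * adj H' (H p.1))%g.
  by rewrite mulgA.
apply: eqfun_ext.
  apply: kfun_ext => // p q f; apply: smash_heq; try exact: e.
  exact: hom_eq_refl.
move=> c p; apply: smash_heq; rewrite /= ?mulgA //.
by rewrite fmor1 cmp1m; exact: hom_eq_refl.
Qed.
Next Obligation.
by move=> B A H; apply: eqnat_ext => p; exact: degmor_ext.
Qed.
Next Obligation.
by move=> B A H I J t s; apply: eqnat_ext => p; exact: degmor_ext.
Qed.
Next Obligation.
move=> B A A' H' I' H I t s.
apply: eqnat_cell_eq; try exact: smash_2fun_obligation_2.
by move=> p; apply: smash_heq; rewrite /= ?mulgA.
Qed.

End SmashProduct.

(* Main.v *)
(* A morphism of degree b^-1 a from x to y in C/G has a single nonzero entry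
   A_a x -> A_b y up to the action, so h |-> h_(b,a) identifies the morphisms
   x^(a) -> y^(b) of (C/G)#G with C(A_a x, A_b y): this is the fully faithful
   functor eps', x^(a) |-> A_a x, and eps sends x to x^(1) and f to P(f).
   Likewise the first row of a morphism h from x^(a) to y^(b) of (B#G)/G lists
   the homogeneous components of a unique morphism x -> y of B: omega', the sum
   of that row, is fully faithful with degree adjuster x^(a) |-> a, and omega is
   its inverse on the objects x^(1). Identities in (C/G)#G and (B#G)/G are
   checked after applying the faithful functors eps' and omega'. *)

Require Import Defs.
From mathcomp Require Import all_boot ssralg.
From mathcomp Require Import boolp classical_sets functions cardinality fsbigop.
(* [fingraph.orbit] would otherwise hide the orbit category. *)
Import Defs.

Set Implicit Arguments.
Unset Strict Implicit.
Unset Printing Implicit Defensive.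

Import GRing.Theory.
Local Open Scope classical_set_scope.
Local Open Scope ring_scope.
#[local] Obligation Tactic := idtac.

(** * Transformations whose naturality squares are filled by identities *)

Section StrictTransformations.
Context (S T : twocat).

(** The squares commute by provable, not computational, equality of 1-cells, so the identity filling
    such a square has to be transported. *)
Definition idto2 (x y : T) (f g : hom1 x y) (e : f = g) : hom2 f g :=
  match e in _ = h return hom2 f h with erefl => id2 f end.

Lemma idto2_cell (x y : T) (f g : hom1 x y) (e : f = g) : idto2 e ==2 id2 g.
Proof. by case: _ / e; exact: cell_eq_refl. Qed.

Lemma idto2_iso (x y : T) (f g : hom1 x y) (e : f = g) : is_iso2 (idto2 e).
Proof. by case: _ / e; exists (id2 f); split; exact: vcomp_idl. Qed.

Lemma isomorphic1_eq (x y : T) (f g : hom1 x y) : f = g -> isomorphic1 f g.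
Proof. by move=> e; exists (idto2 e); exact: idto2_iso. Qed.

Lemma isomorphic1_sym (x y : T) (f g : hom1 x y) :
  isomorphic1 f g -> isomorphic1 g f.
Proof. by move=> [s [t [ts st]]]; exists t, s. Qed.

(** Once both equations are eliminated, [s] and [t] are parallel, hence equal. This gives the
    compatibility with 2-morphisms in [strict_twonat]. *)
Lemma vcomp_idto2 (x y : T) (f f' g g' : hom1 x y) (s : hom2 f g)
    (t : hom2 f' g') (e : f = f') (e' : g = g') :
  s ==2 t -> vcomp (idto2 e') s = vcomp t (idto2 e).
Proof.
move: e e' s t; do 2 case: _ /; move=> s t /cell_eq_eq ->.
by rewrite /= vcomp_idl vcomp_idr.
Qed.

Program Definition strict_twonat (F F' : twofun S T)
    (t : forall x, hom1 (F x) (F' x))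
    (t_nat : forall x y (f : hom1 x y),
      comp1 (fun1 F' f) (t x) = comp1 (t y) (fun1 F f))
    (t_nat2 : forall x y (f g : hom1 x y) (s : hom2 f g),
      hcomp (fun2 F' s) (id2 (t x)) ==2 hcomp (id2 (t y)) (fun2 F s)) :
    twonat F F' :=
  @TwoNat S T F F' t (fun x y f => idto2 (t_nat x y f)) _ _.
Next Obligation. by move=> *; exact: idto2_iso. Qed.
Next Obligation. by move=> *; exact: vcomp_idto2. Qed.

Lemma strict_twonatP (F F' : twofun S T) t t_nat t_nat2 :
  strictly_2natural (@strict_twonat F F' t t_nat t_nat2).
Proof. by move=> x y f; split; [exact: t_nat | exact: idto2_cell]. Qed.

End StrictTransformations.

(** * Identities up to transport, and fully faithful functors *)

Section FullyFaithful.
Context (k : comPzRingType).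
Implicit Types C D : kcat k.

Lemma heq_id_iso C (x y z : C) (f : hom C x y) : f === idm z -> is_iso f.
Proof. by move/heq_sym; case; exists (idm z); exact: inverses_id. Qed.

(** A morphism that is an identity only up to equality of its endpoints still acts neutrally;
    coherence checks between equal but not convertible objects reduce to this. *)
Lemma heq_cmp_idl C (x y z t : C) (g : hom C y z) (f : hom C x y) :
  g === idm t -> g \c f === f.
Proof.
move/heq_sym/heq_inv => [p [q ->]]; move: f q; case: _ / p => f.
by case: _ /; rewrite cmp1m; exact: hom_eq_refl.
Qed.

Lemma heq_cmp_idr C (x y z t : C) (g : hom C y z) (f : hom C x y) :
  f === idm t -> g \c f === g.
Proof.
move/heq_sym/heq_inv => [p [q ->]]; move: g p; case: _ / q => g.
by case: _ /; rewrite cmpm1; exact: hom_eq_refl.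
Qed.

(** Fullness lifts the inverse, faithfulness lifts the two equations it satisfies. *)
Lemma iso_reflect C D (F : kfun C D) :
  (forall x y, injective (@fmor k C D F x y)) ->
  (forall x y (f : hom D (F x) (F y)), exists h, fmor F h = f) ->
  forall x y (h : hom C x y), is_iso (fmor F h) -> is_iso h.
Proof.
move=> inj full x y h [f [fh hf]]; have [g gf] := full _ _ f.
by exists g; split; apply: inj; rewrite fmorM fmor1 gf.
Qed.

End FullyFaithful.

(** * Invertible 2-cells from componentwise inverses *)

Section IsoCells.
Context (k : comPzRingType) (G : groupType).

(** Composing the naturality and equivariance squares of [s] with the inverses on both sides gives
    those of the inverse family. *)
Lemma eqnat_iso2 (C D : gcat k G) (E E' : eqfun C D) (s : eqnat E E') :
  (forall x, is_iso (s x)) -> is_iso2 (T := GCat k G) s.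
Proof.
move=> si; have sV x := invmP (si x).
have nV x y (f : hom C x y) :
    invm (si y) \c fmor E' f = fmor E f \c invm (si x).
  rewrite -[LHS]cmpm1 -(proj2 (sV x)) cmpA -[_ \c _ \c s x]cmpA -nnat !cmpA.
  by rewrite (proj1 (sV y)) cmp1m.
have eV a x : KNat nV (act C a x) \c rho E' a x =
    rho E a x \c fmor (act D a) (KNat nV x).
  rewrite -[LHS]cmpm1 -(fmor1 (act D a)) -(proj2 (sV x)) fmorM cmpA /=.
  by rewrite -[_ \c rho E' a x \c _]cmpA -enatP cmpA (proj1 (sV _)) cmp1m.
exists (EqNat eV : eqnat E' E).
by split; apply: eqnat_ext => x; have [] := sV x.
Qed.

(** The inverse is given explicitly so that its degree can be controlled; its naturality follows
    from that of [s]. *)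
Lemma degnat_iso2 (B A : grcat k G) (H I : degfun B A) (s : degnat H I)
    (t : forall x, hom A (I x) (H x)) :
  (forall x, inverses (s x) (t x)) ->
  (forall x, deg A ((adj H x)^-1 * adj I x)%g (t x)) ->
  is_iso2 (T := GGrCat k G) s.
Proof.
move=> sV td.
have nV x y (f : hom B x y) : t y \c fmor I f = fmor H f \c t x.
  rewrite -[LHS]cmpm1 -(proj2 (sV x)) cmpA -[_ \c _ \c s x]cmpA -nnat !cmpA.
  by rewrite (proj1 (sV y)) cmp1m.
exists (@DegNat _ _ _ _ I H (KNat nV) td).
by split; apply: degnat_ext => x; have [] := sV x.
Qed.

End IsoCells.

(** * The transformations [eps] and [eps'] for G-categories *)

Section UnitOfGCat.
Context (k : comPzRingType) (G : groupType).
Implicit Types C D : gcat k G.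

Lemma heq_ent C (x y : C) (h : orbmat x y) b a b' a' :
  b = b' -> a = a' -> ent h b a === ent h b' a'.
Proof. by move=> -> ->; exact: hom_eq_refl. Qed.

(** All entries in which a morphism of degree [b^-1 a] may be nonzero are translates of the entry at
    [(b, a)], which therefore determines it. *)
Lemma orbit_deg_inj C (x y : C) a b (h h' : hom (orbit_cat C) x y) :
  orbit_deg (b^-1 * a)%g h -> orbit_deg (b^-1 * a)%g h' ->
  ent h b a = ent h' b a -> h = h'.
Proof.
move=> /orbit_degE hd /orbit_degE hd' e; apply: orbmat_ext => d c.
have [->|cd] := pselect (c = d * (b^-1 * a))%g; last by rewrite hd ?hd'.
have [e1 ->] : exists e1, d = (e1 * b)%g by exists (d * b^-1)%g; rewrite mulgVK.
have -> : (e1 * b * (b^-1 * a) = e1 * a)%g by rewrite mulgA mulgK.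
apply: heq_eq; apply: heq_trans (ent_act h e1 b a) _; rewrite e.
exact/heq_sym/ent_act.
Qed.

(** Translating [f] by [b^-1] gives a morphism from [A_(b^-1 a) x] to [y]; the entry at [(b, a)] of
    its image under [P^(1)] is translated back by [b]. *)
Lemma orbit_deg_full C (x y : C) a b (f : hom C (act C a x) (act C b y)) :
  exists2 h : hom (orbit_cat C) x y, orbit_deg (b^-1 * a)%g h & ent h b a = f.
Proof.
have ex : act C (b^-1 * a)%g x = act C b^-1 (act C a x) by exact: actMo.
have ey : act C b^-1 (act C b y) = y by rewrite -actMo mulVg act1o.
pose f1 := idto ey \c fmor (act C b^-1) f \c idto ex.
exists (fmor (orbP C) f1 \c orbpsi C (b^-1 * a)%g x); first by exists f1.
apply: heq_eq; rewrite ent_Pl.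
have e := orbpsi_entE' (b^-1 * a)%g x b; rewrite mulVKg in e.
apply: heq_trans (heq_cmp (hom_eq_refl _) e) _; rewrite cmpm1.
apply: heq_trans (heq_fmor _ (heq_trans (heq_idtor _ _) (heq_idtol _ _))) _.
apply: heq_trans (heq_sym (heq_actM _ _ _)) _.
by rewrite mulgV; exact: heq_act1.
Qed.

Program Definition eps'_fun C : kfun (smash_cat (orbit C)) C :=
  @KFun _ (smash_cat (orbit C)) C (fun p => act C p.2 p.1)
    (fun p q h => ent (dval h : orbmat p.1 q.1) q.2 p.2) _ _ _.
Next Obligation. by move=> C p q t g h; exact: entZD. Qed.
Next Obligation. by move=> C p /=; rewrite orbP_entE fmor1. Qed.
Next Obligation.
move=> C p q r g h; rewrite /= (@fsum1 _ _ q.2) // => c cq.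
have /orbit_degE hd := dvalP h; rewrite hd ?cmpm0 // => e; apply: cq.
by apply: (mulIg (q.2^-1 * p.2)%g); rewrite -e mulVKg.
Qed.

Lemma eps'_inj C p q : injective (@fmor _ _ _ (eps'_fun C) p q).
Proof.
move=> g h e; apply: degmor_ext.
exact: orbit_deg_inj (dvalP g) (dvalP h) e.
Qed.

Lemma eps'_full C p q (f : hom C (eps'_fun C p) (eps'_fun C q)) :
  exists h, fmor (eps'_fun C) h = f.
Proof.
have [h hd <-] := orbit_deg_full f.
by exists (DegMor (hd : deg (orbit C) _ h)).
Qed.

(** Acting by [c] keeps the matrix and multiplies both indices by [c], so this is the equivariance
    of entries. *)
Lemma eps'_act C c (p q : smash_cat (orbit C)) (h : hom _ p q) :
  fmor (eps'_fun C) (fmor (act (smash (orbit C)) c) h) ===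
  fmor (act C c) (fmor (eps'_fun C) h).
Proof. exact: ent_act. Qed.

Program Definition eps' C : eqfun (smash (orbit C)) C :=
  @EqFun k G (smash (orbit C)) C (eps'_fun C)
    (fun c => @KNat _ _ _ _ _ (fun p => idto (esym (actMo c p.2 p.1))) _) _ _.
Next Obligation.
move=> C c p q f; apply: heq_eq.
apply: heq_trans (heq_idtol _ _) _; apply: heq_sym.
by apply: heq_trans (heq_idtor _ _) _; exact: eps'_act.
Qed.
Next Obligation. by move=> C c p; apply: heq_id_iso (heq_idto _). Qed.
Next Obligation.
move=> C a b p; apply: heq_sym; apply: heq_trans (heq_idtol _ _) _.
apply: heq_trans (heq_fmor _ (heq_idto _)) _; rewrite fmor1.
apply: heq_sym; apply: heq_trans (heq_idto _) _.
by apply: heq_idm; exact: actMo.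
Qed.

Lemma eps'_strict C : strictly_equivariant (eps' C).
Proof.
move=> c; split; last by move=> p; exact: heq_idto'.
apply: kfun_ext => [p|p q h]; first exact/esym/actMo.
exact/heq_sym/eps'_act.
Qed.

Lemma orbP_deg C (x y : C) (f : hom C x y) d : d = 1%g ->
  deg (orbit C) d (fmor (orbP C) f).
Proof.
move=> ->; apply/orbit_degE => b a ab.
by apply: orbP_entN; rewrite -[b]mulg1.
Qed.

Lemma orbpsi_deg C (x : C) a d : d = a -> deg (orbit C) d (orbpsi C a x).
Proof. by move=> ->; apply/orbit_degE => b c; exact: orbpsi_entN. Qed.

Program Definition eps_fun C : kfun C (smash_cat (orbit C)) :=
  @KFun _ C (smash_cat (orbit C)) (fun x => (x, 1%g))
    (fun x y f => @DegMor _ _ (orbit C) _ x y (fmor (orbP C) f) _) _ _ _.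
Next Obligation. by move=> C x y f; apply: orbP_deg; rewrite mulVg. Qed.
Next Obligation.
by move=> C x y t f g; apply: degmor_ext; exact: (@fmor_lin _ _ _ (orbP C)).
Qed.
Next Obligation. by move=> C x; apply: degmor_ext; exact: (fmor1 (orbP C)). Qed.
Next Obligation.
by move=> C x y z g f; apply: degmor_ext; exact: (fmorM (orbP C)).
Qed.

Lemma eps'_epsK C (x y : C) (f : hom C x y) :
  fmor (eps'_fun C) (fmor (eps_fun C) f) === f.
Proof. by rewrite /= orbP_entE; exact: heq_act1. Qed.

(* psi_a x as a morphism from x^(a) to (A_a x)^(1); the exponent [p.2] is only
   required to equal [a] because it occurs as [a * 1] in [eps_rho]. *)
Definition smash_psi C (a : G) (p : smash_cat (orbit C))
    (e : (1^-1 * p.2 = a)%g) :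
    hom (smash_cat (orbit C)) p (act C a p.1, 1%g) :=
  @DegMor _ _ (orbit C) _ p.1 (act C a p.1) (orbpsi C a p.1) (orbpsi_deg p.1 e).

Lemma eps'_psi C a p (e : (1^-1 * p.2 = a)%g) :
  fmor (eps'_fun C) (smash_psi e) === idm (act C a p.1).
Proof.
(* The nonzero entry of [psi_a] in row [1] sits in column [1 * a], so the exponent is brought to
   that form. *)
case: p e => x d /= e; have ed : d = (1 * a)%g by rewrite -e invg1 !mul1g.
subst d; apply: heq_trans (orbpsi_entE' a x 1%g) _.
exact/heq_idm/act1o.
Qed.

(** The fully faithful [eps'_fun] sends it to an identity. *)
Lemma smash_psi_iso C a p (e : (1^-1 * p.2 = a)%g) :
  is_iso (@smash_psi C a p e).
Proof.
apply: (@iso_reflect _ _ _ (eps'_fun C)); [exact: eps'_inj|exact: eps'_full|].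
exact: heq_id_iso (eps'_psi e).
Qed.

Lemma eps'_heq C p q p' q' (f : hom (smash_cat (orbit C)) p q)
    (f' : hom (smash_cat (orbit C)) p' q') : p = p' -> q = q' ->
  fmor (eps'_fun C) f === fmor (eps'_fun C) f' -> f === f'.
Proof.
by move=> e e'; subst p' q' => /heq_eq/eps'_inj ->; exact: hom_eq_refl.
Qed.

Fact eps_degE (a : G) : (1^-1 * (a * 1) = a)%g.
Proof. by rewrite invg1 mul1g mulg1. Qed.

(** Acting by [a] on [x^(1)] gives [x^(a)], in general not [(A_a x)^(1)]; [psi_a x] is the
    comparison between the two. *)
Program Definition eps_rho C a :
    knat (kcomp (act (smash (orbit C)) a) (eps_fun C))
         (kcomp (eps_fun C) (act C a)) :=
  @KNat _ _ _ _ _ (fun x => @smash_psi C a (x, a * 1)%g (eps_degE a)) _.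
Next Obligation.
by move=> C a x y f; apply: degmor_ext; exact: (nnat (orbpsi C a)).
Qed.

Lemma eps'_rho C a x : fmor (eps'_fun C) (eps_rho C a x) === idm (act C a x).
Proof. exact: eps'_psi. Qed.

Program Definition eps C : eqfun C (smash (orbit C)) :=
  @EqFun k G C (smash (orbit C)) (eps_fun C) (eps_rho C) _ _.
Next Obligation. by move=> C a x; exact: smash_psi_iso. Qed.
Next Obligation.
(* Under [eps'_fun] every factor becomes an identity, so only objects remain to be compared. *)
move=> C a b x; apply: eps'_heq; try by rewrite /= ?mulgA // actMo.
apply: heq_trans (eps'_rho _ _) _; rewrite fmorM; apply: heq_sym.
apply: heq_trans (heq_cmp_idl _ (eps'_rho _ _)) _.
apply: heq_trans (eps'_act b _) _.
apply: heq_trans (heq_fmor _ (eps'_rho _ _)) _; rewrite fmor1.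
by apply: heq_idm; rewrite -actMo.
Qed.

Lemma rho_comp C D D' (E' : eqfun D D') (E : eqfun C D) a (x : C) :
  rho (eqfun_comp E' E) a x = fmor E' (rho E a x) \c rho E' a (E x).
Proof. by []. Qed.

Lemma eps'_eps C : eqfun_comp (eps' C) (eps C) = eqfun_id C.
Proof.
apply: eqfun_ext => [|a x].
  by apply: kfun_ext => [x|x y f]; [exact: act1o|exact: eps'_epsK].
rewrite rho_comp.
by apply: heq_trans (heq_cmp_idr _ (heq_idto' _)) (eps'_rho _ _).
Qed.

Fact eps_eps'_degE (a : G) : (1^-1 * a = a)%g.
Proof. by rewrite invg1 mul1g. Qed.

(** The composite sends [x^(a)] to [(A_a x)^(1)], so [psi_a x] serves as component once more. *)
Program Definition eps_eps'_knat C :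
    knat (kid (smash_cat (orbit C))) (kcomp (eps_fun C) (eps'_fun C)) :=
  @KNat _ _ _ _ _ (fun p => @smash_psi C p.2 p (eps_eps'_degE p.2)) _.
Next Obligation.
move=> C p q h; apply: eps'_inj; rewrite !fmorM; apply: heq_eq.
apply: heq_trans (heq_cmp_idl _ (eps'_psi _)) _; apply: heq_sym.
by apply: heq_trans (heq_cmp_idr _ (eps'_psi _)) _; exact: eps'_epsK.
Qed.

Lemma eps'_knat C p :
  fmor (eps'_fun C) (eps_eps'_knat C p) === idm (act C p.2 p.1).
Proof. exact: eps'_psi. Qed.

Program Definition eps_eps'_nat C :
    eqnat (eqfun_id (smash (orbit C))) (eqfun_comp (eps C) (eps' C)) :=
  @EqNat _ _ (smash (orbit C)) _ _ _ (eps_eps'_knat C) _.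
Next Obligation.
move=> C c p; apply: eps'_inj; rewrite rho_comp !fmorM; apply: heq_eq.
rewrite fmor1 cmpm1; apply: heq_trans (eps'_knat _) _; apply: heq_sym.
have e : fmor (act C c) (fmor (eps'_fun C) (eps_eps'_knat C p)) ===
    idm (act C c (act C p.2 p.1)).
  apply: heq_trans (heq_fmor _ (eps'_knat _)) _.
  by rewrite fmor1; exact: hom_eq_refl.
apply: heq_trans (heq_cmp_idr _ (heq_trans (eps'_act c _) e)) _.
apply: heq_trans (heq_cmp_idl _ (heq_trans (eps'_epsK _) (heq_idto _))) _.
apply: heq_trans (eps'_rho _ _) _; apply: heq_idm.
by rewrite /= actMo.
Qed.

Lemma eps_eps'_iso C :
  isomorphic1 (T := GCat k G) (eqfun_comp (eps C) (eps' C))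
    (id1 (smash (orbit C) : GCat k G)).
Proof.
apply: isomorphic1_sym; exists (eps_eps'_nat C).
by apply: eqnat_iso2 => p; exact: smash_psi_iso.
Qed.

(** The two equations characterizing [E/G] are what is needed: [HP = P'E] on morphisms, and the
    formula for [H psi_a] on structure cells. *)
Lemma eps_nat C D (E : eqfun C D) :
  eqfun_comp (smash1 (orbit1 E)) (eps C) = eqfun_comp (eps D) E.
Proof.
apply: eqfun_ext => [|a x].
  apply: kfun_ext => [x|x y f]; first by rewrite /= mulg1.
  apply: smash_heq; rewrite /= ?mulg1 //.
  exact: heq_fun (orbH_P E).
rewrite !rho_comp; apply: smash_heq; rewrite /= ?mulg1 //.
apply: eq_heq; apply: etrans (@cmpm1 _ (orbit_cat D) _ _ _) _; exact: orbH_psi.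
Qed.

Lemma eps_nat2 C D (E E' : eqfun C D) (s : eqnat E E') :
  cell_eq (K := @eqnat k G C (smash (orbit D)))
    (eqnat_hcomp (smash2 (orbit2 s)) (eqnat_id (eps C)))
    (eqnat_hcomp (eqnat_id (eps D)) s).
Proof.
apply: eqnat_cell_eq; [exact: eps_nat|exact: eps_nat|move=> x].
apply: smash_heq; rewrite /= ?mulg1 //.
apply: eq_heq; apply: etrans (esym (@cmp1m _ (orbit_cat D) _ _ _)).
apply: etrans (@cmpm1 _ (orbit_cat D) _ _ _); congr (_ \c _).
exact: (fmor1 (orbH E)).
Qed.

Definition eps_2nat : twonat (twofun_id (GCat k G))
    (twofun_comp (smash_2fun k G) (orbit_2fun k G)) :=
  @strict_twonat (GCat k G) (GCat k G) (twofun_id (GCat k G))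
    (twofun_comp (smash_2fun k G) (orbit_2fun k G)) eps eps_nat eps_nat2.

Lemma eps'_smash1 C D (E : eqfun C D) (p q : smash_cat (orbit C))
    (h : hom _ p q) :
  fmor (eps'_fun D) (fmor (smash1 (orbit1 E)) h) ===
  invm (rho_iso E q.2 q.1) \c fmor E (fmor (eps'_fun C) h) \c rho E p.2 p.1.
Proof.
rewrite -/(orbH_ent E (dval h : orbmat p.1 q.1) q.2 p.2).
by apply: (heq_ent (dval (fmor (smash1 (orbit1 E)) h) : orbmat _ _));
  rewrite /= mulg1.
Qed.

Fact adj1_obj C D (E : eqfun C D) (p : smash_cat (orbit C)) :
  act D p.2 (E p.1) = eps' D (smash1 (orbit1 E) p).
Proof. by rewrite /= mulg1. Qed.

(** At [x^(a)] the square compares [E (A_a x)] with [A_a (E x)], hence the inverse of [rho]; [idto]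
    absorbs the exponent [a * 1] produced by the degree adjuster [1]. *)
Program Definition eps'_nat2 C D (E : eqfun C D) :
    eqnat (eqfun_comp E (eps' C)) (eqfun_comp (eps' D) (smash1 (orbit1 E))) :=
  @EqNat _ _ (smash (orbit C)) D _ _ (@KNat _ _ _ _ _
    (fun p => idto (adj1_obj E p) \c invm (rho_iso E p.2 p.1)) _) _.
Next Obligation.
move=> C D E p q h; apply: heq_eq; rewrite -cmpA.
apply: heq_trans (heq_idtol _ _) _; apply: heq_sym; rewrite cmpA.
have e := heq_trans (heq_idtor (adj1_obj E p) _) (eps'_smash1 E h).
apply: heq_trans (heq_cmp e (hom_eq_refl _)) _.
by apply: eq_heq; rewrite -!cmpA (proj2 (invmP _)) cmpm1.
Qed.
Next Obligation.
move=> C D E c p; rewrite !rho_comp; apply: heq_eq.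
set i := invm (rho_iso E p.2 p.1).
have Hi : inverses (rho E p.2 p.1) i by exact: invmP.
set j := invm (rho_iso E c (act C p.2 p.1)).
have Hj : inverses (rho E c (act C p.2 p.1)) j by exact: invmP.
have invM : invm (rho_iso E (c * p.2)%g p.1) === fmor (act D c) i \c j.
  apply: heq_inverses (rhoM E p.2 c p.1); first exact: invmP.
  by apply: inverses_cmp => //; exact: fmor_inverses.
(* Both sides equal [A_c i]: on the left the factor [j] of the inverse of [rho_(c p.2)] cancels
   against [rho_c]. *)
apply: (@heq_trans _ _ _ _ _ _ _ _ _ (fmor (act D c) i)).
  apply: heq_trans (heq_cmp (heq_trans (heq_idtol _ _) invM) _) _.
  - apply: heq_cmp_idl; apply: heq_trans (heq_fmor E (heq_idto _)) _.
    by rewrite fmor1; exact: hom_eq_refl.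
  - by rewrite -cmpA (proj1 Hj) cmpm1; exact: hom_eq_refl.
apply: heq_sym.
apply: heq_trans (heq_cmp_idl _ (heq_trans (heq_cmp_idr _ (heq_idto _)) _)) _.
- apply: heq_trans (heq_fmor (eps' D) ((smash1_strict (orbit1 E) c).2 p)) _.
  by rewrite fmor1; exact: hom_eq_refl.
- exact: (heq_fmor (act D c) (heq_idtol (adj1_obj E p) i)).
Qed.

Lemma eps'_nat2_iso C D (E : eqfun C D) : is_iso2 (T := GCat k G) (eps'_nat2 E).
Proof.
apply: eqnat_iso2 => p.
have [u Hu] : is_iso (idto (adj1_obj E p)) := heq_id_iso (heq_idto _).
exists (rho E p.2 p.1 \c u); apply: inverses_cmp => //.
by have [] := invmP (rho_iso E p.2 p.1).
Qed.

Lemma invm_rho_nat C D (E E' : eqfun C D) (s : eqnat E E') a x :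
  invm (rho_iso E' a x) \c s (act C a x) =
  fmor (act D a) (s x) \c invm (rho_iso E a x).
Proof.
rewrite -[LHS]cmpm1 -(proj2 (invmP (rho_iso E a x))) /= cmpA.
rewrite -[_ \c _ \c rho E a x]cmpA (enatP s a x) cmpA.
by rewrite (proj1 (invmP (rho_iso E' a x))) cmp1m.
Qed.

Lemma eps'_nat2P C D (E E' : eqfun C D) (s : eqnat E E') :
  eqnat_vcomp (eps'_nat2 E') (eqnat_hcomp s (eqnat_id (eps' C))) =
  eqnat_vcomp (eqnat_hcomp (eqnat_id (eps' D)) (smash2 (orbit2 s)))
    (eps'_nat2 E).
Proof.
apply: eqnat_ext => p; apply: heq_eq.
pose a := p.2; pose x := p.1.
apply: (@heq_trans _ _ _ _ _ _ _ _ _ (invm (rho_iso E' a x) \c s (act C a x))).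
  apply: heq_cmp; first exact: heq_idtol.
  by rewrite /= fmor1 cmpm1; exact: hom_eq_refl.
rewrite invm_rho_nat /= cmp1m orbP_entE.
apply: heq_sym; rewrite cmpA; apply: heq_cmp; last exact: hom_eq_refl.
apply: heq_trans (heq_idtor _ _) _.
by rewrite mulg1; exact: hom_eq_refl.
Qed.

Definition eps'_2nat : twonat
    (twofun_comp (smash_2fun k G) (orbit_2fun k G)) (twofun_id (GCat k G)) :=
  @TwoNat (GCat k G) (GCat k G) (twofun_comp (smash_2fun k G) (orbit_2fun k G))
    (twofun_id (GCat k G)) eps' eps'_nat2 eps'_nat2_iso eps'_nat2P.

Lemma eps_iso : is_2natural_iso eps_2nat.
Proof.
move=> C; exists (eps' C : hom1 (t := GCat k G) _ _); split.
  by apply: (@isomorphic1_eq (GCat k G)); exact: eps'_eps.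
exact: eps_eps'_iso.
Qed.

Lemma eps'_iso : is_2natural_iso eps'_2nat.
Proof.
move=> C; exists (eps C : hom1 (t := GCat k G) _ _); split.
  exact: eps_eps'_iso.
by apply: (@isomorphic1_eq (GCat k G)); exact: eps'_eps.
Qed.

End UnitOfGCat.

(** * The transformations [omega] and [omega'] for G-graded categories *)

Section CounitOfGGrCat.
Context (k : comPzRingType) (G : groupType).
Implicit Types B A : grcat k G.

Lemma heq_dval B (p q p' q' : smash_cat B) (f : hom (smash_cat B) p q)
    (f' : hom (smash_cat B) p' q') : f === f' -> dval f === dval f'.
Proof. by case; exact: hom_eq_refl. Qed.

(** Forgetting degrees puts all entries into one module, where they can be compared and summed. *)
Definition smash_ent B (p q : smash B) (h : orbmat p q) (b a : G) :
  hom B p.1 q.1 := dval (ent h b a).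

(** The action on [B#G] does not change underlying morphisms, so every row is a shift of the
    first. *)
Lemma smash_ent1 B (p q : smash B) (h : orbmat p q) b a :
  smash_ent h b a = smash_ent h 1%g (b^-1 * a)%g.
Proof. by apply: heq_eq; exact: heq_dval (ent_eq1 h b a). Qed.

Lemma smash_ent_deg B (p q : smash B) (h : orbmat p q) a d :
  (q.2^-1 * a * p.2 = d)%g -> deg B d (smash_ent h 1%g a).
Proof.
have -> : (q.2^-1 * a * p.2 = (1 * q.2)^-1 * (a * p.2))%g.
  by rewrite mul1g mulgA.
by move=> <-; exact: (dvalP (ent h 1%g a)).
Qed.

Lemma smash_ent_finite B (p q : smash B) (h : orbmat p q) b :
  finite_set [set a | smash_ent h b a <> 0].
Proof.
apply: sub_finite_set (ent_row_finite h b) => a /= ne e.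
by apply: ne; rewrite /smash_ent e.
Qed.

Lemma smash_ext B (p q : smash B) (h h' : orbmat p q) :
  (forall a, smash_ent h 1%g a = smash_ent h' 1%g a) -> h = h'.
Proof.
move=> e; apply: orbmat_ext => b a; apply: degmor_ext.
by rewrite -!/(smash_ent _ _ _) !(smash_ent1 _ b) e.
Qed.

Lemma smash_ent_cmp B (p q r : orbit_cat (smash B))
    (g : hom (orbit_cat (smash B)) q r) (f : hom (orbit_cat (smash B)) p q)
    b a :
  smash_ent (g \c f) b a =
  \sum_(c \in [set: G]) smash_ent g b c \c smash_ent f c a.
Proof.
have fA := ent_row_finite g b.
rewrite /smash_ent ent_cmp (@fsumT _ _ [set c | ent g b c <> 0]); last first.
  by move=> c /contrapT ->; rewrite cmp0m.
rewrite (fsum_morph (h := @dval _ _ B _ p.1 r.1)) // -fsumT //.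
by move=> c /contrapT ->; rewrite cmp0m.
Qed.

Definition omega'_mor B (p q : smash B) (h : orbmat p q) : hom B p.1 q.1 :=
  \sum_(c \in [set: G]) smash_ent h 1%g c.

Program Definition omega'_fun B : kfun (orbit_cat (smash B)) B :=
  @KFun _ (orbit_cat (smash B)) B (fun p => p.1)
    (fun p q h => omega'_mor h) _ _ _.
Next Obligation.
move=> B p q t f g; rewrite /omega'_mor.
have fA : finite_set ([set a | smash_ent f 1%g a <> 0] `|`
    [set a | smash_ent g 1%g a <> 0]).
  by rewrite finite_setU; split; exact: smash_ent_finite.
have e a :
    smash_ent (t *: f + g) 1%g a = t *: smash_ent f 1%g a + smash_ent g 1%g a.
  by rewrite /smash_ent entZD.
set S := (_ `|` _) in fA.
rewrite !(@fsumT _ _ S).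
- rewrite !fsbig_finite // scaler_sumr -big_split /=.
  by apply: eq_bigr => a _; exact: e.
- by move=> a /not_orP[_ /contrapT].
- by move=> a /not_orP[/contrapT].
- move=> a /not_orP[/contrapT f0 /contrapT g0].
  by rewrite e f0 g0 scaler0 addr0.
Qed.
Next Obligation.
move=> B p; rewrite /omega'_mor (@fsum1 _ _ 1%g).
  by rewrite /smash_ent /= orbP_entE.
by move=> c c1; rewrite /smash_ent /= orbP_entN.
Qed.
Next Obligation.
move=> B p q r g f; rewrite /omega'_mor.
pose H := [set c | smash_ent g 1%g c <> 0].
have fH : finite_set H by exact: smash_ent_finite.
(* [F] contains every column reached by a nonzero product, so both sums become finite and can be
   exchanged. *)
pose F := \bigcup_(d in H) [set c | smash_ent f d c <> 0].
have fF : finite_set F.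
  by apply: bigcup_finite => // d _; exact: smash_ent_finite.
transitivity
  (\sum_(c \in F) \sum_(d \in H) smash_ent g 1%g d \c smash_ent f d c).
  rewrite (@fsumT _ _ F).
    apply: eq_fsbigr => c _; rewrite smash_ent_cmp; apply: fsumT.
    by move=> d /contrapT ->; rewrite cmp0m.
  move=> c nF; rewrite smash_ent_cmp; apply: fsbig1 => d _.
  have [->|gd] := pselect (smash_ent g 1%g d = 0); first exact: cmp0m.
  have [->|fd] := pselect (smash_ent f d c = 0); first exact: cmpm0.
  by case: nF; exists d.
rewrite exchange_fsbig //.
rewrite [X in X \c _](@fsumT _ _ H); last by move=> d /contrapT.
rewrite (fsum_morph (h := fun u => u \c omega'_mor f)) //; first last.
- by move=> u v; exact: cmpDm.
- exact: cmp0m.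
apply: eq_fsbigr => d /set_mem Hd.
(* Row [d] of [f] is its first row shifted by [d], hence has the same sum. *)
rewrite /omega'_mor (reindex_fsbigT (fun c => d^-1 * c)%g) /=; last first.
  by exists (fun c => d * c)%g; [exact: mulVKg | exact: mulKg].
rewrite [X in _ \c X](@fsumT _ _ F); last first.
  move=> c nF; rewrite -smash_ent1; apply: contrapT => fd.
  by apply: nF; exists d.
rewrite (fsum_morph (h := fun u => smash_ent g 1%g d \c u)) //; first last.
- by move=> u v; exact: cmpmD.
- exact: cmpm0.
by apply: eq_fsbigr => c _; rewrite (smash_ent1 f d).
Qed.

Lemma omega'_P B (p q : smash B) (f : hom (smash_cat B) p q) :
  fmor (omega'_fun B) (fmor (orbP (smash B)) f) = dval f.
Proof.
rewrite /= /omega'_mor (@fsum1 _ _ 1%g).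
  by rewrite /smash_ent /= orbP_entE.
by move=> c c1; rewrite /smash_ent /= orbP_entN.
Qed.

Lemma omega'_psi B c (p : smash B) :
  fmor (omega'_fun B) (orbpsi (smash B) c p) = idm p.1.
Proof.
rewrite /= /omega'_mor (@fsum1 _ _ (1 * c)%g).
  by apply: heq_eq; exact: (heq_dval (orbpsi_entE c p 1%g)).
by move=> d dc; rewrite /smash_ent /= orbpsi_entN.
Qed.

(** A morphism [P(f) psi_c] goes to the morphism underlying [f], whose degree is read off from its
    source [A_c p] and target [q]. *)
Lemma omega'_deg B c (p q : smash B) (h : hom (orbit_cat (smash B)) p q) :
  orbit_deg c h -> deg B (q.2^-1 * c * p.2)%g (fmor (omega'_fun B) h).
Proof.
move=> [f ->]; rewrite fmorM omega'_P omega'_psi cmpm1.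
by rewrite -mulgA; exact: (dvalP f).
Qed.

(** The first row is the homogeneous decomposition of its sum, hence unique, and it determines the
    whole matrix. *)
Lemma omega'_inj B p q : injective (@fmor _ _ _ (omega'_fun B) p q).
Proof.
move=> h h' e; apply: smash_ext => a.
(* The entry in column [q.2 e p.2^-1] is the one of degree [e]. *)
pose u (h : orbmat p q) e := smash_ent h 1%g (q.2 * e * p.2^-1)%g.
have us g : \sum_(e \in [set: G]) u g e = omega'_mor g.
  rewrite /omega'_mor [RHS](reindex_fsbigT (fun e => q.2 * e * p.2^-1)%g) //.
  exists (fun c => q.2^-1 * c * p.2)%g => c.
    by rewrite !mulgA mulVg mul1g mulgVK.
  by rewrite !mulgA mulgV mul1g mulgK.
have ud g d : deg B d (u g d).
  by apply: smash_ent_deg; rewrite !mulgA mulVg mul1g mulgVK.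
have uf g : finite_set [set d | u g d <> 0].
  have := finite_image (fun c => q.2^-1 * c * p.2)%g (smash_ent_finite g 1%g).
  apply: sub_finite_set => d /= ne; exists (q.2 * d * p.2^-1)%g => //.
  by rewrite !mulgA mulVg mul1g mulgVK.
have uu : u h = u h' by apply: homogeneous_uniq => //; rewrite !us.
have := congr1 (fun v => v (q.2^-1 * a * p.2)%g) uu.
by rewrite /u !mulgA mulgV mul1g mulgK.
Qed.

Lemma omega'_full_deg B c (p q : smash B) (f : hom B p.1 q.1) :
  deg B (q.2^-1 * c * p.2)%g f ->
  exists2 h : hom (orbit_cat (smash B)) p q,
    orbit_deg c h & fmor (omega'_fun B) h = f.
Proof.
rewrite -mulgA => fd.
pose F : hom (smash_cat B) (act (smash B) c p) q := DegMor fd.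
exists (fmor (orbP (smash B)) F \c orbpsi (smash B) c p); first by exists F.
by rewrite fmorM omega'_P omega'_psi cmpm1.
Qed.

(** Each homogeneous component of [f] is lifted by [omega'_full_deg], and the finitely many nonzero
    ones are summed. *)
Lemma omega'_full B (p q : smash B) (f : hom B p.1 q.1) :
  exists h : hom (orbit_cat (smash B)) p q, fmor (omega'_fun B) h = f.
Proof.
have [_ /(_ f) [u [[ud uf ->] _]]] := deg_direct_sum p.1 q.1.
have /choice [h hu] : forall e, exists h : hom (orbit_cat (smash B)) p q,
    fmor (omega'_fun B) h = u e.
  move=> e; have [|h _ hu] := @omega'_full_deg B (q.2 * e * p.2^-1)%g p q (u e).
    by rewrite !mulgA mulVg mul1g mulgVK.
  by exists h.
exists (\sum_(e \in [set e | u e <> 0]) h e).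
rewrite (fsum_morph (h := fmor (omega'_fun B))) //;
  [|exact: fmor0|exact: fmorD].
rewrite (@fsumT _ _ [set e | u e <> 0]); last by move=> a /contrapT.
by apply: eq_fsbigr => e _.
Qed.

Program Definition omega' B : degfun (orbit (smash B)) B :=
  @DegFun k G (orbit (smash B)) B (omega'_fun B) (fun p => p.2) _.
Next Obligation. by move=> B c p q h; exact: omega'_deg. Qed.

Definition omega'_inv B (p q : smash B) (f : hom B p.1 q.1) :
  hom (orbit_cat (smash B)) p q := projT1 (cid (omega'_full f)).

Lemma omega'_invK B (p q : smash B) (f : hom B p.1 q.1) :
  fmor (omega'_fun B) (@omega'_inv B p q f) = f.
Proof. by rewrite /omega'_inv; case: cid. Qed.

(** By faithfulness the chosen preimage coincides with the homogeneous one. *)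
Lemma omega'_inv_deg B c d (p q : smash B) (f : hom B p.1 q.1) :
  deg B d f -> d = (q.2^-1 * c * p.2)%g ->
  deg (orbit (smash B)) c (@omega'_inv B p q f).
Proof.
move=> fd e; rewrite e in fd; have [h hc hf] := omega'_full_deg fd.
suff -> : omega'_inv f = h by [].
by apply: omega'_inj; rewrite omega'_invK.
Qed.

Lemma omega'_invM B (p q r : smash B) (f : hom B p.1 q.1) (g : hom B q.1 r.1) :
  @omega'_inv B q r g \c @omega'_inv B p q f = @omega'_inv B p r (g \c f).
Proof. by apply: omega'_inj; rewrite fmorM !omega'_invK. Qed.

Lemma omega'_inv1 B (p : smash B) :
  @omega'_inv B p p (idm p.1) = idm (p : orbit_cat (smash B)).
Proof. by apply: omega'_inj; rewrite omega'_invK fmor1. Qed.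

Program Definition omega_fun B : kfun B (orbit_cat (smash B)) :=
  @KFun _ B (orbit_cat (smash B)) (fun x => (x, 1%g))
    (fun x y f => @omega'_inv B (x, 1%g) (y, 1%g) f) _ _ _.
Next Obligation.
by move=> B x y t f g; apply: omega'_inj; rewrite fmor_lin !omega'_invK.
Qed.
Next Obligation. by move=> B x; exact: omega'_inv1. Qed.
Next Obligation. by move=> B x y z g f; rewrite omega'_invM. Qed.

Lemma omega'_omegaK B x y (f : hom B x y) :
  fmor (omega'_fun B) (fmor (omega_fun B) f) = f.
Proof. exact: omega'_invK. Qed.

Program Definition omega B : degfun B (orbit (smash B)) :=
  @DegFun k G B (orbit (smash B)) (omega_fun B) (fun=> 1%g) _.
Next Obligation.
move=> B c x y f fc; apply: (@omega'_inv_deg B _ _ (x, 1%g) (y, 1%g) f fc).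
by rewrite invg1 !mul1g !mulg1.
Qed.

Lemma omega'_omega B : degfun_comp (omega' B) (omega B) = degfun_id B.
Proof.
apply: degfun_ext => [|x]; last exact: mulg1.
by apply: kfun_ext => // x y f; apply: eq_heq; exact: omega'_omegaK.
Qed.

(** The composite sends [x^(a)] to [x^(1)]; the component is the unique morphism between them lying
    over the identity of [x]. *)
Program Definition omega_omega'_nat B :
    degnat (degfun_id (orbit (smash B))) (degfun_comp (omega B) (omega' B)) :=
  @DegNat _ _ (orbit (smash B)) _ _ _ (@KNat _ _ _ _ _
    (fun p => @omega'_inv B p (p.1, 1%g) (idm p.1)) _) _.
Next Obligation.
move=> B p q h; apply: omega'_inj; rewrite !fmorM !omega'_invK.
by rewrite cmp1m cmpm1.
Qed.
Next Obligation.
move=> B p; apply: (@omega'_inv_deg B _ _ p (p.1, 1%g) _ (deg_idm p.1)).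
by rewrite /= invg1 mul1g !mulg1 mulVg.
Qed.

Lemma omega_omega'_iso B : isomorphic1 (T := GGrCat k G)
  (degfun_comp (omega B) (omega' B)) (id1 (orbit (smash B) : GGrCat k G)).
Proof.
apply: isomorphic1_sym; exists (omega_omega'_nat B).
apply: (@degnat_iso2 k G _ _ _ _ (omega_omega'_nat B)
  (fun p : smash B => @omega'_inv B (p.1, 1%g) p (idm p.1))) => p.
  by split; rewrite omega'_invM cmp1m -omega'_inv1.
apply: (@omega'_inv_deg B _ _ (p.1, 1%g) p _ (deg_idm p.1)).
by rewrite /= invg1 mul1g !mulg1 mulVg.
Qed.

(** The structure cells of [H#G] have identities as underlying morphisms, so conjugation by them is
    invisible in [B]. *)
Lemma smash_ent_orbH B A (H : degfun B A) (p q : smash B) (h : orbmat p q) b a :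
  smash_ent (orbH_mat (smash1 H) h) b a = fmor H (smash_ent h b a).
Proof.
rewrite /smash_ent /= /orbH_ent /= cmpm1.
have [e _] := invmP (rho_iso (smash1 H) b q).
have := congr1 (fun f : smash_hom _ _ => dval f) e.
by rewrite /= cmpm1 => ->; rewrite cmp1m.
Qed.

Lemma omega'_orbH B A (H : degfun B A) (p q : smash B)
    (h : hom (orbit_cat (smash B)) p q) :
  fmor (omega'_fun A) (fmor (orbH (smash1 H)) h) =
  fmor H (fmor (omega'_fun B) h).
Proof.
rewrite /= /omega'_mor.
rewrite [in RHS](@fsumT _ _ [set a | smash_ent h 1%g a <> 0]); last first.
  by move=> a /contrapT.
rewrite (fsum_morph (h := fmor H)) //.
- rewrite -fsumT => [|a /contrapT ->]; last exact: fmor0.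
  by apply: eq_fsbigr => a _; exact: smash_ent_orbH.
- exact: smash_ent_finite.
- exact: fmor0.
- exact: fmorD.
Qed.

Lemma omega'_nat B A (H : degfun B A) :
  degfun_comp H (omega' B) = degfun_comp (omega' A) (orbit1 (smash1 H)).
Proof.
apply: degfun_ext => [|p]; last by rewrite /= mul1g.
by apply: kfun_ext => // p q h; apply: eq_heq; apply/esym; exact: omega'_orbH.
Qed.

Lemma omega'_nat2 B A (H I : degfun B A) (s : degnat H I) :
  cell_eq (K := @degnat k G (orbit (smash B)) A)
    (degnat_hcomp s (degnat_id (omega' B)))
    (degnat_hcomp (degnat_id (omega' A)) (orbit2 (smash2 s))).
Proof.
apply: degnat_cell_eq; [exact: omega'_nat|exact: omega'_nat|move=> p].
apply: eq_heq; rewrite [LHS]/= fmor1 cmpm1; apply/esym.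
by apply: etrans (@cmp1m _ _ _ _ _) _; exact: (omega'_P (smash2 s p)).
Qed.

Definition omega'_2nat : twonat (twofun_comp (orbit_2fun k G) (smash_2fun k G))
    (twofun_id (GGrCat k G)) :=
  @strict_twonat (GGrCat k G) (GGrCat k G)
    (twofun_comp (orbit_2fun k G) (smash_2fun k G)) (twofun_id (GGrCat k G))
    omega' omega'_nat omega'_nat2.

(** One way around the square ends in [(H x)^(r_x)], the other in [(H x)^(1)]; the morphism over the
    identity of [H x] joins them. *)
Program Definition omega_nat2 B A (H : degfun B A) :
    degnat (degfun_comp (orbit1 (smash1 H)) (omega B))
           (degfun_comp (omega A) H) :=
  @DegNat _ _ B (orbit (smash A)) _ _ (@KNat _ _ _ _ _
    (fun x => @omega'_inv A (H x, 1 * adj H x)%g (H x, 1%g) (idm (H x))) _) _.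
Next Obligation.
move=> B A H x y f; apply: omega'_inj; rewrite !fmorM.
rewrite [X in X \c _]omega'_invK [X in _ = _ \c X]omega'_invK cmp1m cmpm1.
transitivity (fmor H f); last exact/esym/(omega'_omegaK (fmor H f)).
apply: etrans (omega'_orbH H (fmor (omega_fun B) f)) _.
by rewrite omega'_omegaK.
Qed.
Next Obligation.
move=> B A H x.
apply: (@omega'_inv_deg A _ _ (H x, 1 * adj H x)%g (H x, 1%g) _
  (deg_idm (H x))).
by rewrite /= invg1 !mul1g !mulg1 mulVg.
Qed.

Lemma omega_nat2_iso B A (H : degfun B A) :
  is_iso2 (T := GGrCat k G) (omega_nat2 H).
Proof.
apply: (@degnat_iso2 k G _ _ _ _ (omega_nat2 H) (fun x =>
  @omega'_inv A (H x, 1%g) (H x, 1 * adj H x)%g (idm (H x)))) => x.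
  by split; rewrite omega'_invM cmp1m omega'_inv1.
apply: (@omega'_inv_deg A _ _ (H x, 1%g) (H x, 1 * adj H x)%g _
  (deg_idm (H x))).
by rewrite /= !mul1g !mulg1 invg1 mul1g mulVg.
Qed.

Lemma omega_nat2P B A (H I : degfun B A) (s : degnat H I) :
  degnat_vcomp (omega_nat2 I)
    (degnat_hcomp (orbit2 (smash2 s)) (degnat_id (omega B))) =
  degnat_vcomp (degnat_hcomp (degnat_id (omega A)) s) (omega_nat2 H).
Proof.
apply: degnat_ext => x; apply: omega'_inj.
rewrite !fmorM; rewrite [X in X \c _]omega'_invK [X in _ = _ \c X]omega'_invK.
(* Under [omega'_fun] every factor other than [s x] becomes an identity. *)
transitivity (s x).
  pose w := fmor (orbH (smash1 H)) (idm ((x, 1%g) : orbit_cat (smash B))).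
  transitivity (idm (I x) \c (fmor (omega'_fun A)
    (fmor (orbP (smash A)) (smash2 s (x, 1%g))) \c
    fmor (omega'_fun A) w)) => //.
  by rewrite cmp1m omega'_P /w fmor1 fmor1 [LHS]cmpm1.
transitivity (fmor (omega'_fun A) (idm ((I x, 1%g) : orbit_cat (smash A))) \c
  fmor (omega'_fun A) (fmor (omega_fun A) (s x)) \c idm (H x)) => //.
by rewrite cmpm1 fmor1 omega'_omegaK [RHS]cmp1m.
Qed.

Definition omega_2nat : twonat (twofun_id (GGrCat k G))
    (twofun_comp (orbit_2fun k G) (smash_2fun k G)) :=
  @TwoNat (GGrCat k G) (GGrCat k G) (twofun_id (GGrCat k G))
    (twofun_comp (orbit_2fun k G) (smash_2fun k G))
    omega omega_nat2 omega_nat2_iso omega_nat2P.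

Lemma omega'_iso : is_2natural_iso omega'_2nat.
Proof.
move=> B; exists (omega B : hom1 (t := GGrCat k G) _ _); split.
  exact: omega_omega'_iso.
by apply: (@isomorphic1_eq (GGrCat k G)); exact: omega'_omega.
Qed.

Lemma omega_iso : is_2natural_iso omega_2nat.
Proof.
move=> B; exists (omega' B : hom1 (t := GGrCat k G) _ _); split.
  by apply: (@isomorphic1_eq (GGrCat k G)); exact: omega'_omega.
exact: omega_omega'_iso.
Qed.

End CounitOfGGrCat.

(** * The triangle identities *)

Section Triangles.
Context (k : comPzRingType) (G : groupType).

(** On morphisms it amounts to [omega'] undoing [P], on structure cells to [omega'] sending each
    [psi_c] to an identity. *)
Lemma smash_triangle (B : grcat k G) :
  eqfun_comp (smash1 (omega' B)) (eps (smash B)) = eqfun_id (smash B).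
Proof.
apply: eqfun_ext => [|c p].
  apply: kfun_ext => [[x a]|p q f]; first by rewrite /= mul1g.
  apply: smash_heq; try by case: p q {f} => [? ?] [? ?]; rewrite /= mul1g.
  by apply: eq_heq; exact: omega'_P.
rewrite rho_comp; apply: smash_heq;
  try by case: p => [? ?]; rewrite /= ?mulg1 ?mul1g.
by apply: eq_heq; apply: etrans (cmpm1 _) _; exact: omega'_psi.
Qed.

(** This is the decomposition of [h] through [P^(1)]; as first-row entries end in [A_1 y] and not in
    [y], the factor [psi_1 y] appears. *)
Lemma psi1_cmp (C : gcat k G) (x y : C) (h : hom (orbit_cat C) x y) :
  orbpsi C 1%g y \c h =
  \sum_(a \in [set: G]) fmor (orbP C) (ent h 1%g a) \c orbpsi C a x.
Proof.
apply: orbmat_ext => b a; rewrite ent_fsum; first last.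
- apply: sub_finite_set (ent_row_finite h 1%g) => c ne e.
  by apply: ne; rewrite e fmor0 cmp0m.
- by move=> c; exists (ent h 1%g c).
rewrite ent_Pl ent_cmp (@fsum1 _ _ (b * 1)%g) => [|c cb]; last first.
  by rewrite /= orbpsi_entN // cmp0m.
apply: heq_eq; apply: heq_trans (heq_cmp_idl _ (orbpsi_entE 1%g y b)) _.
apply: heq_trans (heq_ent h (mulg1 b) (erefl a)) _.
apply: heq_trans (ent_eq1 h b a) _; apply: heq_sym.
apply: heq_cmp_idr; have := orbpsi_entE (b^-1 * a)%g x b.
by rewrite mulVKg; exact.
Qed.

Lemma orbit_triangle (C : gcat k G) :
  degfun_comp (omega' (orbit C)) (orbit1 (eps C)) = degfun_id (orbit C).
Proof.
apply: degfun_ext => [|x]; last exact: mulg1.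
apply: kfun_ext => // x y h; apply: eq_heq.
(* Each first-row entry of the image of [h] under [eps/G] is [u P(h_(1,a)) psi_a x]; by [psi1_cmp]
   they sum to [u psi_1 h], and [u] inverts [psi_1]. *)
pose u : hom (orbit_cat C) (act C 1%g y) y :=
  dval (invm (rho_iso (eps C) 1%g y)).
have uV : u \c orbpsi C 1%g y = idm y.
  have [e _] := invmP (rho_iso (eps C) 1%g y).
  exact: (congr1 (fun f : smash_hom _ _ => dval f) e).
transitivity (u \c (orbpsi C 1%g y \c h)); last by rewrite cmpA uV cmp1m.
rewrite psi1_cmp (@fsumT _ _ [set a | ent h 1%g a <> 0]); last first.
  by move=> a /contrapT ->; rewrite fmor0 cmp0m.
rewrite (fsum_morph (h := fun v => u \c v)); first last.
- by move=> v w; exact: cmpmD.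
- exact: cmpm0.
- exact: ent_row_finite.
rewrite -fsumT => [|a /contrapT ->]; last by rewrite fmor0 cmp0m cmpm0.
by apply: eq_fsbigr => a _; rewrite cmpA.
Qed.

End Triangles.

Theorem theorem7p5 (k : comPzRingType) (G : groupType) :
  is_2equivalence (orbit_2fun k G) /\
  is_2equivalence (smash_2fun k G) /\
  mutual_2quasi_inverses (orbit_2fun k G) (smash_2fun k G) /\
  two_equivalent (GCat k G) (GGrCat k G) /\
  exists (eps : twonat (twofun_id (GCat k G))
                       (twofun_comp (smash_2fun k G) (orbit_2fun k G)))
         (eps' : twonat (twofun_comp (smash_2fun k G) (orbit_2fun k G))
                        (twofun_id (GCat k G)))
         (omega : twonat (twofun_id (GGrCat k G))
                         (twofun_comp (orbit_2fun k G) (smash_2fun k G)))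
         (omega' : twonat (twofun_comp (orbit_2fun k G) (smash_2fun k G))
                          (twofun_id (GGrCat k G))),
    [/\ is_2natural_iso eps, is_2natural_iso eps',
        is_2natural_iso omega & is_2natural_iso omega'] /\
    (forall C : GCat k G,
      [/\ comp1 (eps' C) (eps C) = id1 C,
          isomorphic1 (comp1 (eps C) (eps' C))
                      (id1 (smash_2fun k G (orbit_2fun k G C))) &
          strictly_equivariant (eps' C)]) /\
    (forall B : GGrCat k G,
      [/\ comp1 (omega' B) (omega B) = id1 B,
          isomorphic1 (comp1 (omega B) (omega' B))
                      (id1 (orbit_2fun k G (smash_2fun k G B))) &
          strictly_degree_preserving (omega B)]) /\
    [/\ strictly_2natural eps,
        strictly_2natural omega',
        strictly_left_2adjoint eps omega',
        (forall B : GGrCat k G,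
          comp1 (fun1 (smash_2fun k G) (omega' B)) (eps (smash_2fun k G B)) =
          id1 (smash_2fun k G B)) &
        (forall C : GCat k G,
          comp1 (omega' (orbit_2fun k G C)) (fun1 (orbit_2fun k G) (eps C)) =
          id1 (orbit_2fun k G C))].
Proof.
(* Quasi-inverses ask for isomorphisms towards the identities, so [eps'] and [omega'] are the ones
   used. *)
have GCatP : two_isomorphic (twofun_comp (smash_2fun k G) (orbit_2fun k G))
    (twofun_id (GCat k G)).
  by exists (eps'_2nat k G); exact: eps'_iso.
have GGrCatP : two_isomorphic (twofun_comp (orbit_2fun k G) (smash_2fun k G))
    (twofun_id (GGrCat k G)).
  by exists (omega'_2nat k G); exact: omega'_iso.
have mutual : mutual_2quasi_inverses (orbit_2fun k G) (smash_2fun k G) by [].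
have orbitP : is_2equivalence (orbit_2fun k G) by exists (smash_2fun k G).
split; first exact: orbitP.
split; first by exists (orbit_2fun k G).
split; first exact: mutual.
split; first by exists (orbit_2fun k G).
have eps_strict : strictly_2natural (eps_2nat k G) by exact: strict_twonatP.
have omega'_strict : strictly_2natural (omega'_2nat k G).
  by exact: strict_twonatP.
exists (eps_2nat k G), (eps'_2nat k G), (omega_2nat k G), (omega'_2nat k G).
split.
  by split; [exact: eps_iso|exact: eps'_iso|exact: omega_iso|exact: omega'_iso].
split.
  by move=> C; split; [exact: eps'_eps|exact: eps_eps'_iso|exact: eps'_strict].
split.
  by move=> B; split; [exact: omega'_omega|exact: omega_omega'_iso|by []].
by split=> //; [split=> //|..];
  by [exact: smash_triangle|exact: orbit_triangle].
Qed.
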